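(* Every weakly Blaschke convex body $B\subset\mathbb{R}^3$ is an ellipsoid.
   Context: A convex body is a compact convex set with non-empty interior which contains $0$. A line is $B$-supporting if it meets $B$ and intersects $B$ only in points of the boundary $\partial B$. A convex body $B\subset\mathbb{R}^3$ has the weak Blaschke property (or is weakly Blaschke) if for any line $L\subset\mathbb{R}^3$ there exists an affine plane $H\subset\mathbb{R}^3$ such that $H$ intersects the interior of $B$ and every point of $H\cap\partial B$ lies on some $B$-supporting translate of $L$. Here ''ellipsoid'' means an ellipsoid with non-empty interior and arbitrary center (not necessarily the origin). *)

(* Defs.v *)
From HB Require Import structures.
From mathcomp Require Import all_boot all_order all_algebra.
From mathcomp Require Import all_classical all_reals all_analysis.
Set Implicit Arguments.
Unset Strict Implicit.
Unset Printing Implicit Defensive.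
Import Order.TTheory GRing.Theory Num.Theory.
Import numFieldNormedType.Exports.
Local Open Scope classical_set_scope.
Local Open Scope ring_scope.

Definition boundary (T : topologicalType) (A : set T) : set T :=
  closure A `\` A°.

Section ConvexBodies.
Context {R : realType} {n : nat}.
Implicit Types A B L H : set 'rV[R]_n.

Definition convex_body B : Prop :=
  [/\ compact B, convex_set B, B° !=set0 & B 0].

Definition translate (p : 'rV[R]_n) A : set 'rV[R]_n :=
  [set p + x | x in A].

Definition is_flat (k : nat) A : Prop :=
  exists (p : 'rV[R]_n) (V : {vspace 'rV[R]_n}),
    \dim V = k /\ A = translate p [set` V].

Definition is_line L : Prop := is_flat 1 L.

Definition is_plane H : Prop := is_flat 2 H.

Definition supporting B L : Prop :=
  L `&` B !=set0 /\ L `&` B `<=` boundary B.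

(* The norm that MathComp-Analysis puts on 'rV[R]_n is the sup norm, so the
   Euclidean ball has to be written out. *)
Definition euclidean_ball : set 'rV[R]_n :=
  [set x | \sum_(i < n) x 0 i ^+ 2 <= 1].

Definition is_ellipsoid B : Prop :=
  exists (c : 'rV[R]_n) (M : 'M[R]_n),
    M \in unitmx /\ B = [set c + x *m M | x in euclidean_ball].

End ConvexBodies.

Definition weakly_blaschke (R : realType) (B : set 'rV[R]_3) : Prop :=
  forall L : set 'rV[R]_3, is_line L ->
  exists H : set 'rV[R]_3,
    [/\ is_plane H,
        H `&` B° !=set0
      & forall x, (H `&` boundary B) x ->
        exists p : 'rV[R]_3, supporting B (translate p L) /\ translate p L x].

(* Main.v *)
(* The proof goes through projections. For a direction [u], the plane given by
   the weak Blaschke property is transversal to [u], and the projection along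
   [u] onto it, [x |-> x - (f_u . x - c_u) u] with [f_u . u = 1], maps [B] into
   itself.

   The difference body [C = B - B] inherits linear projections with the same
   [f_u]. If [p] strictly exposes the point [a] of [C], then [f_u . a = 0] for
   every [u] orthogonal to [p], so these projections preserve each slice
   [{y in C | p . y = t}] and fix its point on the line through [a]. The support
   function [s] of the slice and [v |-> s (- v)] then satisfy the same
   first-order inequalities, so their ratio is constant along segments, hence 1:
   the slices are centrally symmetric and the half-turn
   [y |-> 2 (p . y / p . a) a - y] preserves [C]. These half-turns preserve an
   ellipsoid of maximal volume in [C]; as the exposing [p] are dense, this
   forces [C] to be a multiple of that ellipsoid.

   In coordinates where [C] is the unit ball, [f_u = u / |u|^2] and a supporting
   plane touches [B] in one point. The coordinate [u . y] of the touching point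
   is then the same for all normals orthogonal to [u], and it is linear in [u].
   After a translation the touching point is parallel to the normal, so the
   support function is a multiple of the norm. *)
Require Import Defs.
From mathcomp Require Import all_boot all_order all_algebra.
From mathcomp Require Import all_classical all_reals all_analysis.
From mathcomp Require Import ring lra.
Set Implicit Arguments.
Unset Strict Implicit.
Unset Printing Implicit Defensive.
Import Order.TTheory GRing.Theory Num.Theory.
Import numFieldNormedType.Exports.
Local Open Scope classical_set_scope.
Local Open Scope ring_scope.

(** * Dot and cross products *)

Section Dot.
Context {R : realType} {n : nat}.
Implicit Types (u v w : 'rV[R]_n) (a : R).

Definition dot u v : R := \sum_i u 0 i * v 0 i.

Lemma dotC u v : dot u v = dot v u.
Proof. by apply: eq_bigr => i _; rewrite mulrC. Qed.

Lemma dotDl u v w : dot (u + v) w = dot u w + dot v w.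
Proof. by rewrite -big_split; apply: eq_bigr => i _; rewrite mxE mulrDl. Qed.

Lemma dotZl a u v : dot (a *: u) v = a * dot u v.
Proof. by rewrite mulr_sumr; apply: eq_bigr => i _; rewrite mxE mulrA. Qed.

Lemma dotDr u v w : dot u (v + w) = dot u v + dot u w.
Proof. by rewrite dotC dotDl !(dotC u). Qed.

Lemma dotZr a u v : dot u (a *: v) = a * dot u v.
Proof. by rewrite dotC dotZl dotC. Qed.

Lemma dotNl u v : dot (- u) v = - dot u v.
Proof. by rewrite -scaleN1r dotZl mulN1r. Qed.

Lemma dotNr u v : dot u (- v) = - dot u v.
Proof. by rewrite dotC dotNl dotC. Qed.

Lemma dot0l u : dot 0 u = 0.
Proof. by rewrite -(scale0r u) dotZl mul0r. Qed.

Lemma dot0r u : dot u 0 = 0.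
Proof. by rewrite dotC dot0l. Qed.

Definition dotE :=
  (dotDl, dotDr, dotNl, dotNr, dotZl, dotZr, dot0l, dot0r).

Lemma dot_ge0 u : 0 <= dot u u.
Proof. by apply: sumr_ge0 => i _; rewrite -expr2 sqr_ge0. Qed.

Lemma dot_eq0 u : (dot u u == 0) = (u == 0).
Proof.
apply/eqP/eqP => [|->]; last by rewrite dot0l.
move=> /eqP; rewrite psumr_eq0 => [/allP z|i _]; last by rewrite -expr2 sqr_ge0.
by apply/rowP => i; rewrite mxE; have := z i (mem_index_enum i);
  rewrite -expr2 sqrf_eq0 => /eqP.
Qed.

Lemma dot_gt0 u : (0 < dot u u) = (u != 0).
Proof. by rewrite lt0r dot_ge0 andbT dot_eq0. Qed.

Lemma cauchy_schwarz u v : dot u v ^+ 2 <= dot u u * dot v v.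
Proof.
have [->|v0] := eqVneq v 0; first by rewrite !dotE; lra.
have vv : 0 < dot v v by rewrite dot_gt0.
have := dot_ge0 (dot v v *: u - dot u v *: v).
rewrite !dotE (dotC v u) [leRHS](_ : _ = dot v v * (dot u u * dot v v - dot u v ^+ 2)); last by ring.
by rewrite pmulr_rge0// subr_ge0.
Qed.

Lemma dot_mulmx u v (M : 'M[R]_n) : dot (u *m M) v = dot u (v *m M^T).
Proof.
rewrite /dot; under eq_bigr do rewrite mxE mulr_suml.
rewrite exchange_big; apply: eq_bigr => i _; rewrite mxE mulr_sumr.
by apply: eq_bigr => j _; rewrite mxE -mulrA (mulrC (M i j)).
Qed.

End Dot.

Section Cross.
Context {R : realType}.
Implicit Types u v w : 'rV[R]_3.

Lemma sum3 (F : 'I_3 -> R) : \sum_i F i = F 0 + F 1 + F 2%:R.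
Proof.
rewrite !big_ord_recl big_ord0 addr0 addrA.
by congr (_ + F _ + F _); exact: val_inj.
Qed.

Lemma row3P u v :
  u 0 0 = v 0 0 -> u 0 1 = v 0 1 -> u 0 2%:R = v 0 2%:R -> u = v.
Proof.
move=> h0 h1 h2; apply/rowP => -[[|[|[|//]]] i].
- by have -> : Ordinal i = 0 by exact: val_inj.
- by have -> : Ordinal i = 1 by exact: val_inj.
- by have -> : Ordinal i = 2%:R by exact: val_inj.
Qed.

(** Addition in ['I_3] is modulo 3, so one cyclic formula gives all three coordinates. *)
Definition cross u v : 'rV[R]_3 :=
  \row_i (u 0 (i + 1) * v 0 (i + 2%:R) - u 0 (i + 2%:R) * v 0 (i + 1)).

Lemma crossE u v :
  [/\ cross u v 0 0 = u 0 1 * v 0 2%:R - u 0 2%:R * v 0 1,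
      cross u v 0 1 = u 0 2%:R * v 0 0 - u 0 0 * v 0 2%:R &
      cross u v 0 2%:R = u 0 0 * v 0 1 - u 0 1 * v 0 0].
Proof.
have e1 : (1 + 2%:R : 'I_3) = 0 by exact: val_inj.
have e2 : (2%:R + 1 : 'I_3) = 0 by exact: val_inj.
have e3 : (2%:R + 2%:R : 'I_3) = 1 by exact: val_inj.
by split; rewrite mxE ?add0r ?e1 ?e2 ?e3.
Qed.

Lemma dot_crossl u v : dot (cross u v) u = 0.
Proof. by rewrite /dot sum3; have [-> -> ->] := crossE u v; ring. Qed.

Lemma dot_crossr u v : dot (cross u v) v = 0.
Proof. by rewrite /dot sum3; have [-> -> ->] := crossE u v; ring. Qed.

Lemma cross_cross u v w : cross w (cross u v) = dot w v *: u - dot w u *: v.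
Proof.
have [e0 e1 e2] := crossE w (cross u v); have [f0 f1 f2] := crossE u v.
apply: row3P; rewrite ?e0 ?e1 ?e2 ?f0 ?f1 ?f2 !mxE /dot !sum3; ring.
Qed.

Lemma crossr0 u : cross u 0 = 0.
Proof. by apply/rowP => i; rewrite !mxE !mulr0 subr0. Qed.

(** By the triple product formula [w] has zero cross product with [cross u v]; a second expansion
    gives the proportionality, free of division so that [u] and [v] may be dependent. *)
Lemma perp_perp u v w : dot w u = 0 -> dot w v = 0 ->
  dot (cross u v) (cross u v) *: w = dot w (cross u v) *: cross u v.
Proof.
move=> wu wv; have : cross (cross u v) (cross w (cross u v)) = 0.
  by rewrite (cross_cross u v w) wu wv !scale0r subr0 crossr0.
rewrite cross_cross => /eqP; rewrite subr_eq0 => /eqP ->.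
by rewrite dotC.
Qed.

Lemma perp_ex u : exists2 p, p != 0 & dot p u = 0.
Proof.
have [u0|u0] := eqVneq (u 0 0) 0.
  exists (delta_mx 0 0); last by rewrite /dot sum3 !mxE /= u0; ring.
  by apply/eqP => /rowP/(_ 0)/eqP; rewrite !mxE oner_eq0.
exists (cross u (delta_mx 0 2%:R)); last exact: dot_crossl.
have [_ e _] := crossE u (delta_mx 0 2%:R).
apply/eqP => /rowP/(_ 1)/eqP; rewrite e !mxE /= mulr0 mulr1 sub0r oppr_eq0.
exact/negP.
Qed.

Lemma cross_eq0 u v w : cross u v = 0 -> u != 0 -> dot w u = 0 -> dot w v = 0.
Proof.
move=> c0 u0 wu; have : cross u (cross u v) = 0 by rewrite c0 crossr0.
rewrite cross_cross => /eqP; rewrite subr_eq0 => /eqP e.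
have : dot u u * dot w v = 0 by rewrite -dotZr -e dotZr wu mulr0.
by move/eqP; rewrite mulf_eq0 dot_eq0 (negPf u0) => /eqP.
Qed.

Lemma perp2_ex u v : exists p, [/\ p != 0, dot p u = 0 & dot p v = 0].
Proof.
have [c0|] := eqVneq (cross u v) 0; last first.
  by exists (cross u v); rewrite dot_crossl dot_crossr.
have [u0|u0] := eqVneq u 0.
  by have [p p0 pv] := perp_ex v; exists p; rewrite u0 dotE.
have [p p0 pu] := perp_ex u; exists p; split=> //.
exact: cross_eq0 c0 u0 pu.
Qed.

End Cross.

(** * Telescoping *)

Section Telescoping.
Context {R : realType}.

(** Cut [0, 1] into [N] equal steps and add up: the first-order terms telescope to
    [(k 1 - k 0) / N], the quadratic ones sum to [b / N], and both tend to 0. *)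
Lemma telescope_le (psi k : R -> R) (b d : R) : 0 < d ->
  (forall l m : R, 0 <= l -> l <= m -> m <= 1 -> m - l <= d ->
     psi m - psi l <= (k m - k l) * (m - l) + b * (m - l) ^+ 2) ->
  psi 1 <= psi 0.
Proof.
move=> d0 H; rewrite leNgt; apply/negP => lt01.
pose e := psi 1 - psi 0; have e0 : 0 < e by rewrite subr_gt0.
(* Any [N > c] makes the step [1 / N] at most [d] and the total error smaller than the supposed gap
   [e]. *)
pose c : R := `|(k 1 - k 0 + b) / e| + d^-1.
have c0 : 0 < c by rewrite ltr_wpDl// ?invr_gt0.
pose N := Num.bound c; have cN : c < N%:R by apply: archi_boundP; exact: ltW.
have N0 : 0 < N%:R :> R by exact: lt_trans cN.
have Nd : N%:R^-1 <= d.
  rewrite -[leRHS]invrK lef_pV2 ?posrE ?invr_gt0//.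
  by rewrite (le_trans _ (ltW cN))// /c lerDr.
have Ne : k 1 - k 0 + b < N%:R * e.
  rewrite -ltr_pdivrMr// (le_lt_trans (ler_norm _))// (le_lt_trans _ cN)//.
  by rewrite /c lerDl invr_ge0 ltW.
have step i : (i <= N)%N -> psi (i%:R / N%:R) - psi 0 <=
    (k (i%:R / N%:R) - k 0) / N%:R + b * i%:R / N%:R ^+ 2.
  elim: i => [_|i IH iN]; first by rewrite !mul0r !subrr mulr0 !mul0r addr0.
  have {IH} := IH (ltnW iN).
  have gap : i.+1%:R / N%:R - i%:R / N%:R = N%:R^-1 :> R.
    by rewrite -mulrBl -natrB// subSnn mul1r.
  have := H (i%:R / N%:R) (i.+1%:R / N%:R); rewrite gap => /(_ _ _ _ Nd) {}H.
  have {}H : psi (i.+1%:R / N%:R) - psi (i%:R / N%:R) <=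
      (k (i.+1%:R / N%:R) - k (i%:R / N%:R)) / N%:R + b / N%:R ^+ 2.
    rewrite -exprVn; apply: H; first by rewrite divr_ge0.
    - by rewrite ler_pM2r ?invr_gt0// ler_nat.
    - by rewrite ler_pdivrMr// mul1r ler_nat.
  move=> IH; rewrite -[i.+1%:R]natr1 mulrDr mulr1 mulrDl.
  by move: H IH; rewrite -[i.+1%:R]natr1 !mulrBl; lra.
have := step N (leqnn N); rewrite divff ?gt_eqF// -[psi 1 - psi 0]/e leNgt => /negP; apply.
by rewrite expr2 invfM mulrA mulfK ?gt_eqF// -mulrDl ltr_pdivrMr// mulrC.
Qed.

(** Because the slope [k] is shared, the ratios at [l] and [m] compare up to the factor
    [(1 - t * k m) * (1 + t * k l)], with [t = m - l]. It differs from 1 by a telescoping term and a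
    quadratic one. *)
Lemma ratio_le (S S' k : R -> R) (d K : R) : 0 < d ->
  (forall l : R, -1 <= l <= 2 -> d <= S l <= K) ->
  (forall l : R, -1 <= l <= 2 -> d <= S' l <= K) ->
  (forall l m : R, -1 <= l <= 2 -> -1 <= m <= 2 ->
     (1 + (m - l) * k l) * S l <= S m) ->
  (forall l m : R, -1 <= l <= 2 -> -1 <= m <= 2 ->
     (1 + (m - l) * k l) * S' l <= S' m) ->
  S 1 / S' 1 <= S 0 / S' 0.
Proof.
move=> d0 bS bS' cS cS'.
have S0 (l : R) : -1 <= l <= 2 -> 0 < S l by move=> /bS/andP[/(lt_le_trans d0)].
have S'0 (l : R) : -1 <= l <= 2 -> 0 < S' l by move=> /bS'/andP[/(lt_le_trans d0)].
pose L := K / d.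
have L1 : 1 <= L.
  rewrite ler_pdivlMr// mul1r; have /bS/andP[] : -1 <= (0 : R) <= 2 by lra.
  exact: le_trans.
have L0 : 0 < L by lra.
(* Unit steps from a point of [0, 1] stay in [-1, 2]; the bounds on [S] there bound the slope. *)
have kL (l : R) : 0 <= l <= 1 -> - L <= k l <= L.
  move=> l01; have l12 : -1 <= l <= 2 by lra.
  have aux (x : R) : x * S l <= K -> x <= L.
    move=> xS; have [x0|x0] := leP 0 x; last exact: le_trans (ltW x0) (ltW L0).
    rewrite ler_pdivlMr//; apply: le_trans xS; rewrite ler_wpM2l//.
    by case/andP: (bS _ l12).
  have h1 : -1 <= l + 1 <= 2 by lra.
  have h2 : -1 <= l - 1 <= 2 by lra.
  have a1 : (1 + (l + 1 - l) * k l) <= L.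
    by apply: aux; apply: le_trans (cS _ _ l12 h1) _; case/andP: (bS _ h1).
  have a2 : (1 + (l - 1 - l) * k l) <= L.
    by apply: aux; apply: le_trans (cS _ _ l12 h2) _; case/andP: (bS _ h2).
  lra.
apply: (@telescope_le (fun l => S l / S' l) (fun l => L * k l) (L ^+ 3) L^-1).
  by rewrite invr_gt0.
move=> l m l0 lm m1; rewrite -[L^-1]mul1r ler_pdivlMr//; set t := m - l => tL.
have t0 : 0 <= t by rewrite subr_ge0.
have l12 : -1 <= l <= 2 by lra.
have m12 : -1 <= m <= 2 by lra.
have /andP[kl1 kl2] : - L <= k l <= L by apply: kL; lra.
have /andP[km1 km2] : - L <= k m <= L by apply: kL; lra.
pose al := 1 - t * k m; pose be := 1 + t * k l.
have al0 : 0 <= al by rewrite /al; nra.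
have be0 : 0 <= be by rewrite /be; nra.
have Sl : al * S m <= S l.
  by have := cS m l m12 l12; rewrite -opprB -/t mulNr.
have Sm : be * S l <= S m by exact: cS.
have S'm : be * S' l <= S' m by exact: cS'.
have ab1 : al * be <= 1.
  rewrite -(ler_pM2r (S0 _ l12)) mul1r -mulrA.
  by apply: le_trans Sl; rewrite ler_wpM2l.
have SSm : S m / S' m <= L.
  rewrite /L ler_pM//; [by rewrite ltW// S0|
    by rewrite invr_ge0 ltW// S'0|by case/andP: (bS _ m12)|].
  by rewrite lef_pV2 ?posrE ?S'0//; case/andP: (bS' _ m12).
have : al * be * (S m / S' m) <= S l / S' l.
  rewrite ler_pdivlMr ?S'0//; apply: le_trans Sl.
  rewrite [leLHS](_ : _ = al * ((be * S' l) * (S m / S' m))); last by ring.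
  rewrite ler_wpM2l//; have /ler_wpM2r/(_ _ _ S'm)/le_trans : 0 <= S m / S' m.
    by rewrite divr_ge0 // ltW// ?S0 ?S'0.
  by apply; rewrite mulrC divfK// gt_eqF ?S'0.
move=> h; have : S m / S' m - S l / S' l <= L * (1 - al * be).
  apply: (@le_trans _ _ ((1 - al * be) * (S m / S' m))); first lra.
  by rewrite mulrC ler_wpM2r// subr_ge0.
move/le_trans; apply.
have -> : 1 - al * be = t * (k m - k l) + t ^+ 2 * (k m * k l) by rewrite /al /be; ring.
have : k m * k l <= L ^+ 2 by nra.
have t2 : 0 <= L * t ^+ 2 by rewrite mulr_ge0 ?sqr_ge0// ltW.
by move/(ler_wpM2l t2); lra.
Qed.

End Telescoping.

(** * Radial support functions *)

Section Radial.
Context {R : realType}.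
Implicit Types p q : 'rV[R]_3.

(** Read [g] as a support function: the hypothesis puts the touching point for [p] at
    [(g p / dot p p) *: p]. The squared quotient [psi] of [g] by the norm then grows at most to
    second order along segments between orthogonal vectors, hence is constant. *)
Lemma radial_const (g : 'rV[R]_3 -> R) :
  (forall p q, p != 0 -> q != 0 -> g p * dot p q <= g q * dot p p) ->
  exists2 r, 0 <= r & forall p, p != 0 -> g p = r * Num.sqrt (dot p p).
Proof.
move=> H.
have g0 p : p != 0 -> 0 <= g p.
  move=> p0; have [q q0 qp] := perp_ex p.
  by have := H q p q0 p0; rewrite qp mulr0 pmulr_lge0 ?dot_gt0.
pose psi p := g p ^+ 2 / dot p p.
have psi0 p : 0 <= psi p by rewrite divr_ge0 ?sqr_ge0 ?dot_ge0.
have gpsi p : p != 0 -> g p ^+ 2 = psi p * dot p p.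
  by move=> p0; rewrite divfK// dot_eq0.
have H2 p q : p != 0 -> q != 0 -> 0 <= dot p q ->
    psi p * dot p q ^+ 2 <= psi q * dot q q * dot p p.
  move=> p0 q0 pq; rewrite -(ler_pM2r (_ : 0 < dot p p)) ?dot_gt0//.
  rewrite [leLHS](_ : _ = (g p * dot p q) ^+ 2); last by rewrite exprMn gpsi//; ring.
  rewrite [leRHS](_ : _ = (g q * dot p p) ^+ 2); last by rewrite exprMn gpsi//; ring.
  rewrite ler_sqr ?nnegrE ?H//.
    by rewrite mulr_ge0 ?g0.
  by rewrite mulr_ge0 ?g0 ?dot_ge0.
have perp p q : p != 0 -> q != 0 -> dot p q = 0 -> psi q <= psi p.
  move=> p0 q0 pq; pose c (l : R) := (1 - l) *: p + l *: q.
  set P := dot p p; set Q := dot q q.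
  have P0 : 0 < P by rewrite dot_gt0.
  have Q0 : 0 < Q by rewrite dot_gt0.
  have cc l m : dot (c l) (c m) = (1 - l) * (1 - m) * P + l * m * Q.
    by rewrite !dotE (dotC q p) pq -/P -/Q; ring.
  have cpq l : P * Q <= dot (c l) (c l) * (P + Q).
    by rewrite cc -subr_ge0 [leRHS](_ : _ = ((1 - l) * P - l * Q) ^+ 2) ?sqr_ge0//; ring.
  have cn0 l : c l != 0.
    rewrite -dot_gt0 -(pmulr_lgt0 _ (addr_gt0 P0 Q0)).
    by apply: lt_le_trans (cpq l); exact: mulr_gt0.
  (* Comparing [c l] with both endpoints bounds [psi] on the whole segment. *)
  have cb l : 0 <= l <= 1 -> psi (c l) <= psi p + psi q.
    move=> /andP[l0 l1]; rewrite -(ler_pM2r (_ : 0 < dot (c l) (c l))) ?dot_gt0//.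
    have clp : dot (c l) p = (1 - l) * P by rewrite !dotE (dotC q p) pq -/P; ring.
    have clq : dot (c l) q = l * Q by rewrite !dotE pq -/Q; ring.
    have := H2 _ _ (cn0 l) p0; rewrite clp -/P => /(_ _)/= hp.
    have {}hp : psi (c l) * ((1 - l) ^+ 2 * P) <= psi p * dot (c l) (c l).
      rewrite -(ler_pM2r P0) [leLHS](_ : _ = psi (c l) * ((1 - l) * P) ^+ 2); last by ring.
      by rewrite [leRHS]mulrAC hp// mulr_ge0 ?subr_ge0// ltW.
    have := H2 _ _ (cn0 l) q0; rewrite clq -/Q => /(_ _)/= hq.
    have {}hq : psi (c l) * (l ^+ 2 * Q) <= psi q * dot (c l) (c l).
      rewrite -(ler_pM2r Q0) [leLHS](_ : _ = psi (c l) * (l * Q) ^+ 2); last by ring.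
      by rewrite [leRHS]mulrAC hq// mulr_ge0// ltW.
    rewrite mulrDl; apply: le_trans (lerD hp hq).
    by rewrite cc le_eqVlt; apply/orP; left; apply/eqP; ring.
  have -> : p = c 0 by rewrite /c subr0 scale1r scale0r addr0.
  have -> : q = c 1 by rewrite /c subrr scale1r scale0r add0r.
  (* This combines the bound [psi p + psi q] with the lower bound [P * Q / (P + Q)] for the squared
     norms on the segment. *)
  pose b := (psi p + psi q) * (P + Q) ^+ 2 / (P * Q).
  apply: (@telescope_le _ (psi \o c) (fun=> 0) b 1) => // l m l0 lm m1 _ /=.
  rewrite subrr mul0r add0r.
  have PQ : 0 < P * Q by exact: mulr_gt0.
  have clm : 0 <= dot (c m) (c l).
    by rewrite cc addr_ge0// mulr_ge0 ?(ltW P0) ?(ltW Q0)// mulr_ge0 ?subr_ge0//; lra.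
  have := H2 _ _ (cn0 m) (cn0 l) clm.
  (* Lagrange's identity: the defect in the Cauchy-Schwarz inequality is of second order in
     [m - l]. *)
  have lagr : dot (c m) (c l) ^+ 2 = dot (c m) (c m) * dot (c l) (c l) - (m - l) ^+ 2 * (P * Q).
    by rewrite !cc; ring.
  have /cb pm : 0 <= m <= 1 by lra.
  have nl := cpq l; have nm := cpq m; rewrite lagr.
  set x := psi (c m) in pm *; set y := psi (c l).
  set A := dot (c m) (c m) in nm *; set B := dot (c l) (c l) in nl *.
  have A0 : 0 < A by rewrite dot_gt0.
  have B0 : 0 < B by rewrite dot_gt0.
  move=> h; have {}h : (x - y) * (A * B) <= x * (m - l) ^+ 2 * (P * Q) by move: h; lra.
  have h2 : (x - y) * (A * B) <= (psi p + psi q) * (m - l) ^+ 2 * (P * Q).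
    by apply: le_trans h _; rewrite ler_wpM2r ?(ltW PQ)// ler_wpM2r// sqr_ge0.
  have AB : (P * Q) ^+ 2 <= (A * B) * (P + Q) ^+ 2.
    have := ler_pM (ltW PQ) (ltW PQ) nm nl; rewrite -expr2 => /le_trans; apply.
    by rewrite le_eqVlt; apply/orP; left; apply/eqP; ring.
  rewrite /b [leRHS](_ : _ = (psi p + psi q) * (m - l) ^+ 2 * (P + Q) ^+ 2 / (P * Q));
    last by ring.
  rewrite ler_pdivlMr// -(ler_pM2r (mulr_gt0 A0 B0)).
  have k0 : 0 <= (psi p + psi q) * (m - l) ^+ 2 by rewrite mulr_ge0 ?sqr_ge0 ?addr_ge0.
  have := ler_wpM2r (ltW PQ) h2; have := ler_wpM2l k0 AB.
  by move=> h3 h4; nra.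
have eqpsi p q : p != 0 -> q != 0 -> psi p = psi q.
  move=> p0 q0; have [s [s0 sp sq]] := perp2_ex p q.
  have -> : psi p = psi s by apply/eqP; rewrite eq_le !perp// dotC.
  by apply/eqP; rewrite eq_le !perp// dotC.
have e0 : const_mx 1 != 0 :> 'rV[R]_3.
  by apply/eqP => /rowP/(_ 0)/eqP; rewrite !mxE oner_eq0.
exists (Num.sqrt (psi (const_mx 1))); first exact: sqrtr_ge0.
by move=> p p0; rewrite -sqrtrM// (eqpsi _ p)// -gpsi// sqrtr_sqr ger0_norm// g0.
Qed.

End Radial.

(** * Compact convex sets *)

Section Topology.
Context {R : realType} {n : nat}.
Implicit Types (A B : set 'rV[R]_n) (q x y z o : 'rV[R]_n).

Lemma continuous_mul_fun (T : topologicalType) (f g : T -> R) :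
  continuous f -> continuous g -> continuous (fun t => f t * g t).
Proof. by move=> cf cg t; apply: cvgM; [exact: cf|exact: cg]. Qed.

Lemma continuous_mull_fun (T : topologicalType) (c : R) (f : T -> R) :
  continuous f -> continuous (fun t => c * f t).
Proof. by apply: continuous_mul_fun => t; exact: cvg_cst. Qed.

Lemma continuous_sum_fun (T : topologicalType) (I : finType) (f : I -> T -> R) :
  (forall i, continuous (f i)) -> continuous (fun t => \sum_i f i t).
Proof.
by move=> cf; apply: continuous_big => [|i _]; [exact: add_continuous|exact: cf].
Qed.

Lemma dot_continuous (T : topologicalType) (f g : T -> 'rV[R]_n) :
  continuous f -> continuous g -> continuous (fun t => dot (f t) (g t)).
Proof.
move=> cf cg; apply: continuous_sum_fun => i.
have cc (h : T -> 'rV[R]_n) : continuous h -> continuous (fun t => h t 0 i).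
  move=> ch t; apply: (@continuous_comp _ _ _ h (fun M : 'rV[R]_n => M 0 i)); first exact: ch.
  exact: coord_continuous.
by apply: continuous_mul_fun; exact: cc.
Qed.

Lemma dot_continuousr q : continuous (dot q).
Proof.
apply: (@dot_continuous _ (cst q) id); first exact: cst_continuous.
by move=> x; exact: cvg_id.
Qed.

Lemma compact_max_ex (T : topologicalType) (A : set T) (f : T -> R) :
  compact A -> A !=set0 -> continuous f ->
  exists2 a, A a & forall t, A t -> f t <= f a.
Proof.
move=> cA A0 cf; have [a aA am] := compact_EVT_max A0 cA (continuous_subspaceT cf).
by exists a => [|t tA]; [exact/set_mem | apply/am/mem_set].
Qed.

Lemma convex_setP B : convex_set B <-> forall x y (t : R), B x -> B y ->
  0 <= t -> t <= 1 -> B (t *: x + (1 - t) *: y).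
Proof.
split=> [cB x y t Bx By t0 t1|cB].
  by have /set_mem := cB x y (Itv01 t0 t1) (mem_set Bx) (mem_set By).
move=> x y t /set_mem Bx /set_mem By; apply/mem_set.
by have := cB x y t%:num Bx By; apply.
Qed.

(* The nearest point of [B] gives the separating functional. *)
Lemma convex_separation B x : compact B -> convex_set B -> B !=set0 ->
  (forall q, exists2 b, B b & dot q x <= dot q b) -> B x.
Proof.
move=> cB /convex_setP vB B0 H.
have cx : continuous (fun y : 'rV[R]_n => y - x).
  by move=> y; apply: (@cvgB _ _ _ (nbhs y) _ id (cst _)); [exact: cvg_id|exact: cvg_cst].
have cd := dot_continuous cx cx.
have [b /set_mem Bb bmin] := compact_EVT_min B0 cB (continuous_subspaceT cd).
have [b' Bb'] := H (x - b); rewrite -subr_ge0 -dotNr -dotDr => h.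
have [->//|bx] := eqVneq x b; exfalso.
have [p pE] : exists p, p = x - b by eexists.
have [r rE] : exists r, r = b' - b by eexists.
rewrite -pE in h.
have p0 : 0 < dot p p by rewrite dot_gt0 pE subr_eq0.
have pr : dot p p <= dot p r.
  have -> : r = (b' - x) + p by rewrite rE pE addrA subrK.
  by rewrite dotDr lerDr.
have near t : 0 <= t -> t <= 1 -> 2 * t * dot p r <= t ^+ 2 * dot r r.
  move=> t0 t1; have := bmin _ (mem_set (vB _ _ _ Bb' Bb t0 t1)).
  have -> : t *: b' + (1 - t) *: b - x = t *: r - p.
    by rewrite rE pE; apply/rowP => i; rewrite !mxE; ring.
  have -> : b - x = - p by rewrite pE opprB.
  rewrite !dotE (dotC r p); lra.
have r0 : 0 <= dot r r := dot_ge0 r.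
set D := dot r r in near r0; set E := dot p r in pr near.
have D1 : 0 < 1 + D by lra.
have E0 : 0 < E by exact: lt_le_trans pr.
(* A step of this length from [b] towards [b'] would come closer to [x] than [b] does. *)
pose t := Num.min 1 (E / (1 + D)).
have t0 : 0 < t by rewrite lt_min ltr01 divr_gt0.
have t1 : t <= 1 by rewrite ge_min lexx.
have tD : t * (1 + D) <= E by rewrite -ler_pdivlMr// ge_min lexx orbT.
have := near t (ltW t0) t1; rewrite expr2 -!mulrA => h2.
have : 2 * E <= t * D.
  by rewrite -(ler_pM2l t0) mulrCA.
lra.
Qed.

(** Neighbourhoods are given by the sup norm; since the Euclidean norm bounds every coordinate,
    halving the radius leaves room for the strict inequality. *)
Lemma interior_dot_ball B o : B° o ->
  exists2 e : R, 0 < e & forall x, dot (x - o) (x - o) <= e ^+ 2 -> B x.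
Proof.
move=> /nbhs_ballP[e /= e0 eB]; exists (e / 2); first by rewrite divr_gt0.
move=> x xo; apply: eB; split=> // i j; rewrite (ord1 i) /ball /=.
rewrite distrC.
have : (x 0 j - o 0 j) ^+ 2 <= (e / 2) ^+ 2.
  apply: le_trans xo; rewrite /dot (bigD1 j)//= !mxE -expr2 lerDl.
  by apply: sumr_ge0 => k _; rewrite -expr2 sqr_ge0.
rewrite -(real_normK (num_real (_ - _))) ler_sqr ?nnegrE//; last by lra.
move=> h; lra.
Qed.

Lemma interior_of_dot_ball B o (e : R) : 0 < e ->
  (forall x, dot (x - o) (x - o) <= e ^+ 2 -> B x) -> B° o.
Proof.
move=> e0 H.
have cf : continuous (fun x : 'rV[R]_n => dot (x - o) (x - o)).
  have cx : continuous (fun y : 'rV[R]_n => y - o).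
    by move=> y; apply: (@cvgB _ _ _ (nbhs y) _ id (cst _)); [exact: cvg_id|exact: cvg_cst].
  exact: (dot_continuous cx cx).
have : nbhs o [set x | dot (x - o) (x - o) < e ^+ 2].
  apply: (cf o [set t | t < e ^+ 2]); apply: open_nbhs_nbhs; split; first exact: open_lt.
  by rewrite /= subrr dot0l exprn_gt0.
by apply: filterS => x /= /ltW; exact: H.
Qed.

(** The contraction towards [y] with ratio [t] carries a ball about [o] to a ball about the
    combination, still inside [B]. *)
Lemma convex_interior B o y (t : R) : convex_set B -> B° o -> B y ->
  0 < t -> t <= 1 -> B° (t *: o + (1 - t) *: y).
Proof.
move=> /convex_setP cB /interior_dot_ball[e e0 eB] By t0 t1.
apply: (@interior_of_dot_ball _ _ (t * e)); first exact: mulr_gt0.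
pose z := t *: o + (1 - t) *: y; move=> x; rewrite -/z => xz.
have -> : x = t *: (o + t^-1 *: (x - z)) + (1 - t) *: y.
  by rewrite scalerDr scalerA divff ?gt_eqF// scale1r /z; apply/rowP => i; rewrite !mxE; ring.
apply: cB => //; last exact: ltW.
apply: eB; rewrite addrC addKr dotZl dotZr mulrA -expr2 exprVn mulrC.
by rewrite ler_pdivrMr ?exprn_gt0// mulrC -exprMn.
Qed.

(** Take the last parameter in [0, 1] whose point is in [B]; an interior point there would allow a
    later one. *)
Lemma exit_point B o z : closed B -> B o -> ~ B z ->
  exists t : R, [/\ 0 <= t, t < 1, B (o + t *: (z - o)) & ~ B° (o + t *: (z - o))].
Proof.
move=> cB Bo nBz; pose f (t : R) := o + t *: (z - o).
have cf : continuous f.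
  move=> t; apply: (@cvgD _ _ _ (nbhs t) _ (cst o) ( *:%R^~ (z - o))); first exact: cvg_cst.
  exact: scalel_continuous.
have [t [/= t01 Bt] tmax] : exists2 t, (`[0, 1]%classic `&` f @^-1` B) t &
    forall s, (`[0, 1]%classic `&` f @^-1` B) s -> s <= t.
  apply: (@compact_max_ex _ _ id); last by move=> s; exact: cvg_id.
    apply: (subclosed_compact _ (@segment_compact R 0 1)) => [|s []//].
    by apply: closedI; [exact: interval_closed | apply: closed_comp => // s _; exact: cf].
  by exists 0; split; rewrite /= ?in_itv/= ?lexx ?ler01// /f scale0r addr0.
move: t01; rewrite in_itv/= => /andP[t0 t1].
have {}t1 : t < 1.
  rewrite lt_neqAle t1 andbT; apply/eqP => t1'; apply: nBz.
  by move: Bt; rewrite t1' /f scale1r addrC subrK.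
exists t; split=> // /cf /nbhs_ballP[e /= e0 eB].
pose s := t + Num.min (e / 2) (1 - t).
have s1 : s <= 1 by rewrite /s -lerBrDl ge_min lexx orbT.
have ts : t < s by rewrite ltrDl lt_min divr_gt0// subr_gt0.
have : s <= t.
  apply: tmax; split; rewrite /= ?in_itv/= ?s1 ?(le_trans t0 (ltW ts))//.
  apply: eB; rewrite /ball /= distrC /s addrC addKr.
  rewrite ger0_norm ?le_min ?divr_ge0 ?subr_ge0 ?(ltW t1) ?(ltW e0)//.
  by rewrite gt_min ltr_pdivrMr// ltr_pMr// ltr1n.
by rewrite leNgt ts.
Qed.

End Topology.

(** * Projections from the weak Blaschke property *)

Section Projections.
Context {R : realType}.
Implicit Types (B : set 'rV[R]_3) (u v f x y : 'rV[R]_3).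

Definition has_projections B := forall u, u != 0 ->
  exists f (c : R), dot f u = 1 /\
    forall x, B x -> B (x - (dot f x - c) *: u).

Lemma lagrange u v :
  dot (cross u v) (cross u v) = dot u u * dot v v - dot u v ^+ 2.
Proof.
rewrite /dot !sum3; have [-> -> ->] := crossE u v; ring.
Qed.

Lemma plane_normal (V : {vspace 'rV[R]_3}) : \dim V = 2 ->
  exists2 f, f != 0 & forall v, dot f v = 0 -> v \in V.
Proof.
move=> dV; have : basis_of V (vbasis V) := vbasisP V.
have : size (vbasis V) = 2 by rewrite size_tuple.
case: (tval (vbasis V)) => [//|b1 [//|b2 [|//]]] _ bV.
have := basis_free bV; rewrite free_cons span_seq1 seq1_free => /andP[b12 b20].
have f0 : cross b1 b2 != 0.
  apply/eqP => c0; have := cross_cross b1 b2 b2; rewrite c0 crossr0.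
  move/esym/eqP; rewrite subr_eq0 => /eqP e; move/negP: b12; apply.
  apply/vlineP; exists ((dot b2 b2)^-1 * dot b2 b1).
  by rewrite -scalerA -e scalerA mulVf ?scale1r// dot_eq0.
have V1 : b1 \in V by apply: (basis_mem bV); rewrite inE eqxx.
have V2 : b2 \in V by apply: (basis_mem bV); rewrite !inE eqxx orbT.
exists (cross b1 b2) => // v fv.
have f1 := dot_crossl b1 b2; have f2 := dot_crossr b1 b2.
set f := cross b1 b2 in f0 fv f1 f2.
(* Cramer's rule for the Gram system of [b1] and [b2], whose determinant is [dot f f]. The error [w]
   is then orthogonal to [b1], [b2] and [f], hence zero. *)
set a := (dot v b1 * dot b2 b2 - dot v b2 * dot b1 b2).
set b := (dot v b2 * dot b1 b1 - dot v b1 * dot b1 b2).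
pose w := dot f f *: v - a *: b1 - b *: b2.
have w0 : w = 0.
  have wf : dot w f = 0 by rewrite /w !dotE !(dotC _ f) fv f1 f2; ring.
  have w1 : dot w b1 = 0 by rewrite /w !dotE lagrange (dotC b2 b1) /a /b; ring.
  have w2 : dot w b2 = 0 by rewrite /w !dotE lagrange /a /b; ring.
  have /eqP := perp_perp w1 w2; rewrite -/f wf scale0r scaler_eq0 dot_eq0 (negPf f0).
  by move/eqP.
have -> : v = (dot f f)^-1 *: (a *: b1 + b *: b2).
  have <- : dot f f *: v = a *: b1 + b *: b2.
    by apply/eqP; rewrite -subr_eq0 opprD addrA -/w w0.
  by rewrite scalerA mulVf ?scale1r// dot_eq0.
by rewrite memvZ// memvD// memvZ.
Qed.

(** If the projection of [y] onto [H] left [B], the segment to it from an interior point [w] of [H]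
    would exit at a boundary point [x]. The parallel to [u] through [x] is supporting, yet it meets
    the segment from [w] to [y] in an interior point. *)
Lemma weakly_blaschke_projections B :
  convex_body B -> weakly_blaschke B -> has_projections B.
Proof.
move=> [cB vB _ B0] bB u u0.
have clB : closed B by apply: compact_closed => //; exact: norm_hausdorff.
have [|H [[q [V [dV HV]]] [w [Ho wB]] HB]] := bB (translate 0 [set` <[u]>%VS]).
  by exists 0, <[u]>%VS; rewrite dim_vline u0.
have [f f0 fV] := plane_normal dV.
have inH x : dot f (x - w) = 0 -> H x.
  move=> /fV xo; move: Ho; rewrite HV => -[v0 /= v0V v0o]; exists (v0 + (x - w)).
    by rewrite /= memvD.
  by rewrite addrA v0o addrC subrK.
have Bo : B w by exact: interior_subset wB.
(* A translate of the line that passes through [x] is the line through [x] in direction [u]. *)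
have touch x (s : R) : dot f (x - w) = 0 -> B x -> ~ B° x ->
    B (x + s *: u) -> ~ B° (x + s *: u).
  move=> /inH Hx Bx nx Bxs.
  have [|p [[_ sup] [y [l lu <-] xE]]] := HB x.
    by split=> //; split=> //; exact: subset_closure.
  have [] : boundary B (x + s *: u); last by [].
  apply: sup; split=> //; exists (0 + (l + s *: u)).
    by exists (l + s *: u) => //=; rewrite memvD// memvZ// memv_line.
  by rewrite -xE !add0r addrA.
(* If [u] were parallel to [H], the ray from [w] along [u] would leave [B] at a point of [H], and
   its supporting line would contain the interior point [w]. *)
have fu : dot f u != 0.
  apply/eqP => fu0.
  have [b Bb bmax] : exists2 b, B b & forall y, B y -> dot u y <= dot u b.
    apply: compact_max_ex => //; first by exists w.
    exact: dot_continuousr.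
  (* At [w + T *: u] the value of [dot u] exceeds its maximum on [B] by 1. *)
  pose T := (dot u b - dot u w + 1) / dot u u.
  have nT : ~ B (w + T *: u).
    move=> /bmax; rewrite dotDr dotZr divfK ?dot_eq0//; lra.
  have [t [t0 t1]] := exit_point clB Bo nT; rewrite (addrC w (T *: u)) addrK scalerA => Bx nx.
  have := @touch _ (- (t * T)) _ Bx nx; rewrite scaleNr addrK; apply=> //.
  by rewrite addrC addKr dotZr fu0 mulr0.
exists ((dot f u)^-1 *: f), ((dot f u)^-1 * dot f w).
split=> [|y By]; first by rewrite dotZl mulVf.
rewrite dotZl -mulrBr -dotNr -dotDr; set k := _ * _.
apply: contrapT => nz.
have [t [t0 t1 Bx nx]] := exit_point clB Bo nz.
have [t00|tn0] := eqVneq t 0; first by apply: nx; rewrite t00 scale0r addr0.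
have tp : 0 < 1 - t by lra.
have t1' : 1 - t <= 1 by lra.
(* The point [(1 - t) *: w + t *: y] is the exit point shifted by a multiple of [u]. *)
have := convex_interior vB wB By tp t1'.
have -> : (1 - t) *: w + (1 - (1 - t)) *: y = w + t *: (y - k *: u - w) + (t * k) *: u.
  by apply/rowP => i; rewrite !mxE; ring.
move=> int; apply: (touch _ _ _ Bx nx _ int); last exact: (interior_subset int).
rewrite addrC addKr dotZr; have -> : y - k *: u - w = (y - w) - k *: u by rewrite addrAC.
have kf : k * dot f u = dot f (y - w) by rewrite /k mulrC mulrA (mulfV fu) mul1r.
by rewrite dotDr dotNr (dotZr k) kf subrr mulr0.
Qed.

End Projections.

(** * Half-turns *)

Section HalfTurn.
Context {R : realType}.
Implicit Types (C : set 'rV[R]_3) (a p q u v f x y z : 'rV[R]_3).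

Definition exposes C p a := [/\ C a, forall y, C y -> dot p y <= dot p a &
  forall y, C y -> dot p y = dot p a -> y = a].

Definition has_linear_projections C := forall u, u != 0 ->
  exists2 f, dot f u = 1 & forall x, C x -> C (x - dot f x *: u).

(** The vector [p] shows that [a] and [u] are independent, so their common orthogonal complement is
    a line. *)
Lemma perp_collinear a u p v w : u != 0 -> dot p u = 0 -> dot p a != 0 ->
  v != 0 -> dot v a = 0 -> dot v u = 0 -> dot w a = 0 -> dot w u = 0 ->
  w = (dot w v / dot v v) *: v.
Proof.
move=> u0 pu pa v0 va vu wa wu.
have n0 : cross u a != 0.
  by apply: contra_neq pa => /cross_eq0; apply.
set n := cross u a in n0.
have nn0 : dot n n != 0 by rewrite dot_eq0.
have vn : v = (dot v n / dot n n) *: n.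
  by rewrite mulrC -scalerA -(perp_perp vu va) scalerA mulVf// scale1r.
have wn : w = (dot w n / dot n n) *: n.
  by rewrite mulrC -scalerA -(perp_perp wu wa) scalerA mulVf// scale1r.
move: (dot v n / _) (dot w n / _) vn wn v0 => b c -> ->.
rewrite scaler_eq0 negb_or => /andP[b0 _].
by rewrite !dotE scalerA; congr (_ *: _); field; rewrite nn0.
Qed.

Variable C : set 'rV[R]_3.
Hypothesis Ccompact : compact C.
Hypothesis Cconvex : convex_set C.
Variable e : R.
Hypothesis e_gt0 : 0 < e.
Hypothesis Cball : forall x, dot x x <= e ^+ 2 -> C x.
Hypothesis Cproj : has_linear_projections C.

Lemma ball_scale x : exists2 k, 0 < k & C (k *: x).
Proof.
exists (e / (1 + dot x x)).
  by rewrite divr_gt0// ltr_wpDr ?dot_ge0.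
apply: Cball; rewrite !dotE; have x0 := dot_ge0 x; set d := dot x x in x0 *.
rewrite [leLHS](_ : _ = e ^+ 2 * (d / (1 + d) ^+ 2)); last first.
  by field; rewrite gt_eqF//; lra.
rewrite ler_piMr ?sqr_ge0// ler_pdivrMr ?exprn_gt0//; nra.
Qed.

Lemma exposed_gt0 p a : p != 0 -> exposes C p a -> 0 < dot p a.
Proof.
move=> p0 [_ amax _]; have [k k0 /amax] := ball_scale p.
by apply: lt_le_trans; rewrite dotZr mulr_gt0// dot_gt0.
Qed.

(** The projection moves [a] inside its supporting plane, and [a] is the only point of [C] there. *)
Lemma exposed_projection p a u f : exposes C p a -> u != 0 -> dot p u = 0 ->
  (forall x, C x -> C (x - dot f x *: u)) -> dot f a = 0.
Proof.
move=> [Ca _ amax] u0 pu Pf; have /amax := Pf _ Ca.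
rewrite dotDr dotNr dotZr pu mulr0 subr0 => /(_ erefl)/eqP.
by rewrite eq_sym -subr_eq0 opprB addrC subrK scaler_eq0 (negPf u0) orbF => /eqP.
Qed.

(** * Support functions of slices parallel to a supporting plane *)

Section Slice.
Variables (p a : 'rV[R]_3) (t : R).
Hypothesis p_neq0 : p != 0.
Hypothesis pa : exposes C p a.

Definition slice := [set y | C y /\ dot p y = t].

Variable s : 'rV[R]_3 -> R.
Hypothesis s_attained : forall q, exists2 b, slice b & dot q b = s q.
Hypothesis s_max : forall q y, slice y -> dot q y <= s q.

(** Project along [u = cross q p], which preserves the slice. The adjoint of this projection sends
    each [v] orthogonal to [a] to a vector orthogonal to [a] and [u], hence to a multiple of [q].
    The same [Y] serves [s] and its reflection. *)
Lemma slice_support_grows q : q != 0 -> dot q a = 0 -> exists Y, dot q Y = 1 /\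
  forall v, dot v a = 0 ->
    dot v Y * s q <= s v /\ dot v Y * s (- q) <= s (- v).
Proof.
move=> q0 qa; have pa0 := exposed_gt0 p_neq0 pa.
pose u := cross q p.
have u0 : u != 0.
  apply: contra_eq_neq (esym qa) => c0; rewrite eq_sym.
  have aq : dot a q = 0 by rewrite dotC.
  by have := cross_eq0 c0 q0 aq; rewrite dotC => pa_eq0; rewrite pa_eq0 ltxx in pa0.
have [f fu Pf] := Cproj u0.
have uq : dot q u = 0 by rewrite dotC dot_crossl.
have up : dot p u = 0 by rewrite dotC dot_crossr.
have fa : dot f a = 0 := exposed_projection pa u0 up Pf.
have qq : dot q q != 0 by rewrite dot_eq0.
exists ((dot q q)^-1 *: (q - dot f q *: u)); split.
  by rewrite !dotE uq mulr0 subr0 mulVf.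
move=> v va; set Y := _ *: _; pose w := v - dot v u *: f.
have wE : w = dot v Y *: q.
  rewrite (@perp_collinear a u p q w) ?gt_eqF//; last first.
  - by rewrite /w !dotE fu mulr1 subrr.
  - by rewrite /w !dotE fa va mulr0 subrr.
  by congr (_ *: _); rewrite /w /Y !dotE mulrC; ring.
have shear z : slice z -> slice (z - dot f z *: u).
  by move=> [Cz pz]; split; [exact: Pf | rewrite !dotE up mulr0 subr0].
have shear_dot z : dot v (z - dot f z *: u) = dot v Y * dot q z.
  by rewrite -dotZl -wE /w !dotE; ring.
split.
- have [z Sz <-] := s_attained q; rewrite -shear_dot; exact/s_max/shear.
- have [z Sz <-] := s_attained (- q); rewrite dotNl mulrN -shear_dot -dotNl.
  exact/s_max/shear.
Qed.

Hypothesis t_lt : `|t| < dot p a.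
Hypothesis Csym : forall x, C x -> C (- x).

Lemma slice_support_lb (c : R) : 0 < c -> exists2 k, 0 < k &
  forall q, dot q a = 0 -> dot q q <= c -> k * dot q q <= s q.
Proof.
move=> c0; have pa0 := exposed_gt0 p_neq0 pa.
have tm := t_lt; set m := dot p a in pa0 tm *.
have [Ca _ _] := pa.
(* By Cauchy-Schwarz [d] bounds [dot w w] below, so [(e / (1 + d)) *: w] lies in the ball. Mixing it
   with [a] or [- a] in proportion [tau] gives a test point at height [t]. *)
pose d := c * (1 + dot p p * dot a a / m ^+ 2).
have d0 : 0 < d.
  by rewrite mulr_gt0// ltr_wpDr// divr_ge0 ?sqr_ge0// mulr_ge0 ?dot_ge0.
pose tau := `|t| / m; have tau0 : 0 <= tau by rewrite divr_ge0// ltW.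
have tau1 : tau < 1 by rewrite ltr_pdivrMr// mul1r.
exists ((1 - tau) * (e / (1 + d))).
  by rewrite mulr_gt0 ?subr_gt0// divr_gt0//; lra.
move=> q qa qc; pose w := q - (dot p q / m) *: a.
have ww : dot w w <= d.
  rewrite /w !dotE (dotC a q) qa !mulr0 oppr0 addr0 add0r mulrN opprK.
  have := cauchy_schwarz p q; set A := dot a a; set P := dot p p; set Q := dot q q => h.
  rewrite /d [leLHS](_ : _ = Q + dot p q ^+ 2 * (A / m ^+ 2)); last by field; rewrite gt_eqF.
  have Am : 0 <= A / m ^+ 2 by rewrite divr_ge0 ?sqr_ge0 ?dot_ge0.
  have h2 := ler_wpM2r Am h.
  have PAm : 0 <= P * (A / m ^+ 2) by rewrite mulr_ge0// dot_ge0.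
  have h3 := ler_wpM2r PAm qc; rewrite -/Q in qc h3; rewrite -/P -/A.
  lra.
pose sa := if 0 <= t then a else - a.
have Csa : C sa by rewrite /sa; case: ifP => // _; exact: Csym.
have psa : tau * dot p sa = t.
  rewrite /tau /sa; case: (ger0P t) => ht; rewrite ?dotNr -/m; field; exact: lt0r_neq0.
have qsa : dot q sa = 0 by rewrite /sa; case: ifP => _; rewrite ?dotNr qa ?oppr0.
have -> : (1 - tau) * (e / (1 + d)) * dot q q =
    dot q (tau *: sa + (1 - tau) *: ((e / (1 + d)) *: w)).
  by rewrite !dotE qsa qa; ring.
apply: s_max; split; last first.
  rewrite !dotE psa -/m [X in _ + X](_ : _ = 0) ?addr0//.
  by field; rewrite !gt_eqF//; lra.
move/convex_setP: Cconvex; apply=> //; last exact: ltW.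
apply: Cball; rewrite dotZl dotZr mulrA -expr2 exprMn exprVn -mulrA.
rewrite ler_piMr ?sqr_ge0// mulrC ler_pdivrMr ?exprn_gt0//; [nra|lra].
Qed.

Lemma slice_support_ub : exists K, forall q, s q <= K + dot q q.
Proof.
have [b Sb _] := s_attained 0; have C0 : C !=set0 by exists b; case: Sb.
have [c Cc cmax] : exists2 c, C c & forall y, C y -> dot y y <= dot c c.
  apply: compact_max_ex => //.
  by apply: (@dot_continuous _ _ _ id id) => x; exact: cvg_id.
exists (dot c c) => q; have [z [/cmax Cz _] <-] := s_attained q.
have := dot_ge0 (z - q); have := dot_ge0 (z + q); rewrite !dotE (dotC z q).
lra.
Qed.

(** On the segment from [q] to [q'] the two support functions are bounded, bounded away from 0 and
    share their slopes, so [ratio_le] applies. *)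
Lemma slice_support_ratio q q' : q != 0 -> q' != 0 -> dot q a = 0 ->
  dot q' a = 0 -> dot q q' = 0 -> s q' / s (- q') <= s q / s (- q).
Proof.
move=> q0 q'0 qa q'a qq'; pose v (l : R) := (1 - l) *: q + l *: q'.
set P := dot q q; set Q := dot q' q'.
have P0 : 0 < P by rewrite dot_gt0.
have Q0 : 0 < Q by rewrite dot_gt0.
have vv l : dot (v l) (v l) = (1 - l) ^+ 2 * P + l ^+ 2 * Q.
  by rewrite !dotE (dotC q' q) qq' -/P -/Q; ring.
have va l : dot (v l) a = 0 by rewrite !dotE qa q'a !mulr0 addr0.
have vlb l : P * Q / (P + Q) <= dot (v l) (v l).
  rewrite ler_pdivrMr ?addr_gt0// vv -subr_ge0.
  by rewrite [leRHS](_ : _ = ((1 - l) * P - l * Q) ^+ 2) ?sqr_ge0//; ring.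
have lb0 : 0 < P * Q / (P + Q) by rewrite divr_gt0 ?mulr_gt0 ?addr_gt0.
have v0 l : v l != 0 by rewrite -dot_gt0; exact: lt_le_trans (vlb l).
have vub (l : R) : -1 <= l <= 2 -> dot (v l) (v l) <= 4 * (P + Q).
  move=> /andP[l1 l2]; rewrite vv.
  have h1 : (1 - l) ^+ 2 <= 4 by nra.
  have h2 : l ^+ 2 <= 4 by nra.
  have := ler_wpM2r (ltW P0) h1; have := ler_wpM2r (ltW Q0) h2; lra.
have [k k0 sk] : exists2 k, 0 < k & forall q, dot q a = 0 ->
    dot q q <= 4 * (P + Q) -> k * dot q q <= s q.
  by apply: slice_support_lb; rewrite mulr_gt0// addr_gt0.
have [K sK] := slice_support_ub.
have {}sk (l : R) : -1 <= l <= 2 ->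
    k * (P * Q / (P + Q)) <= s (v l) /\ k * (P * Q / (P + Q)) <= s (- v l).
  move=> l12; have h : k * (P * Q / (P + Q)) <= k * dot (v l) (v l).
    by rewrite ler_wpM2l// ltW.
  split; apply: (le_trans h); first by apply: sk; [exact: va|exact: vub].
  have := sk (- v l); rewrite !dotNl va oppr0 dotNr opprK; apply=> //; exact: vub.
have {}sK (l : R) : -1 <= l <= 2 ->
    s (v l) <= K + 4 * (P + Q) /\ s (- v l) <= K + 4 * (P + Q).
  move=> /vub h; split; apply: le_trans (sK _) _; rewrite lerD2l//.
  by rewrite dotNl dotNr opprK.
have /choice[Y HY] l := slice_support_grows (v0 l) (va l).
(* As [dot (v l) (Y l) = 1], the factor [dot (v m) (Y l)] is affine in [m] with value 1 at
   [m = l]. *)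
have step l m : (1 + (m - l) * dot (q' - q) (Y l)) = dot (v m) (Y l).
  have [<- _] := HY l; rewrite !dotE; ring.
have -> : q' = v 1 by rewrite /v subrr scale0r add0r scale1r.
have -> : q = v 0 by rewrite /v subr0 scale0r addr0 scale1r.
apply: (@ratio_le _ (s \o v) (fun l => s (- v l)) (fun l => dot (q' - q) (Y l))
  (k * (P * Q / (P + Q))) (K + 4 * (P + Q))) => /=.
- exact: mulr_gt0.
- by move=> l /[dup] /sk[-> _] /sK[-> _].
- by move=> l /[dup] /sk[_ ->] /sK[_ ->].
- by move=> l m _ _; rewrite step; have [_ /(_ _ (va m))[]] := HY l.
- by move=> l m _ _; rewrite step; have [_ /(_ _ (va m))[]] := HY l.
Qed.

(** Through [r], orthogonal to [q] and [a], the ratio at [q] equals the ratio at [- q], which is its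
    inverse; being positive, it is 1. *)
Lemma slice_support_sym q : dot q a = 0 -> s q = s (- q).
Proof.
have [->|q0 qa] := eqVneq q 0; first by rewrite oppr0.
have pos v : v != 0 -> dot v a = 0 -> 0 < s v.
  move=> v0 va; have vv : 0 < dot v v by rewrite dot_gt0.
  have [k k0 /(_ _ va (lexx _))] := slice_support_lb vv.
  by apply: lt_le_trans; rewrite mulr_gt0.
have pa0 := exposed_gt0 p_neq0 pa.
have a0 : a != 0 by apply: contraTneq pa0 => ->; rewrite dot0r ltxx.
pose r := cross q a.
have ra : dot r a = 0 := dot_crossr q a.
have rq : dot r q = 0 := dot_crossl q a.
have qr : dot q r = 0 by rewrite dotC.
have r0 : r != 0.
  apply/eqP => c0; have := cross_eq0 c0 q0 (_ : dot a q = 0).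
  by rewrite dotC qa => /(_ erefl)/eqP; rewrite dot_eq0 (negPf a0).
have nq0 : - q != 0 by rewrite oppr_eq0.
have nqa : dot (- q) a = 0 by rewrite dotNl qa oppr0.
have rnq : dot r (- q) = 0 by rewrite dotNr rq oppr0.
have nqr : dot (- q) r = 0 by rewrite dotC.
have sq := pos _ q0 qa; have snq := pos _ nq0 nqa.
have h1 : s q / s (- q) <= s (- q) / s q.
  have := slice_support_ratio r0 q0 ra qa rq.
  move/le_trans; apply; have := slice_support_ratio nq0 r0 nqa ra nqr.
  by rewrite opprK.
have h2 : s (- q) / s q <= s q / s (- q).
  have := slice_support_ratio r0 nq0 ra nqa rnq; rewrite opprK.
  by move/le_trans; apply; exact: slice_support_ratio.
have : s q / s (- q) = s (- q) / s q by apply/eqP; rewrite eq_le h1 h2.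
move/(congr1 (fun k : R => k * (s q * s (- q)))).
rewrite [LHS](_ : _ = s q ^+ 2); last by field; rewrite gt_eqF.
rewrite [RHS](_ : _ = s (- q) ^+ 2); last by field; rewrite gt_eqF.
by move/eqP; rewrite eqrXn2 ?ltW// => /eqP.
Qed.

End Slice.

Hypothesis Csym : forall x, C x -> C (- x).

(* Each slice of [C] parallel to the supporting plane is centrally symmetric
   about its point on the line through [a]. *)
Lemma half_turn p a y : p != 0 -> exposes C p a -> C y ->
  C ((2 * dot p y / dot p a) *: a - y).
Proof.
move=> p0 pa Cy; have pa0 := exposed_gt0 p0 pa.
have [Ca amax aeq] := pa.
(* At the two extreme heights [y] is [a] or [- a]; the slice argument covers the heights in
   between. *)
have [pay|pay] := eqVneq (dot p y) (dot p a).
  rewrite (aeq _ Cy pay) -mulrA divff ?gt_eqF// mulr1.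
  by rewrite -{2}(scale1r a) -scalerBl -[2]/(1 + 1) addrK scale1r.
have [pany|pany] := eqVneq (dot p (- y)) (dot p a).
  have ny : - y = a by apply: aeq => //; exact: Csym.
  have -> : y = - a by rewrite -ny opprK.
  rewrite dotNr opprK mulrN mulNr -mulrA divff ?gt_eqF// mulr1.
  have -> : - 2 *: a + a = - a; last exact: Csym.
  by rewrite scaleNr -[2]/(1 + 1) scalerDl !scale1r opprD subrK.
have ty : `|dot p y| < dot p a.
  rewrite ltr_norml; move: pany; rewrite dotNr => pany; apply/andP; split.
    rewrite ltrNl lt_neqAle pany -dotNr amax//; exact: Csym.
  by rewrite lt_neqAle pay amax.
set t := dot p y in ty.
have /choice[b bP] q : exists b, slice p t b /\ forall z, slice p t z -> dot q z <= dot q b.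
  have [|||b Sb bmax] := @compact_max_ex R _ (slice p t) (dot q).
  - apply: (subclosed_compact _ Ccompact) => [|z []//].
    apply: closedI; first by apply: compact_closed => //; exact: norm_hausdorff.
    apply: (@closed_comp _ _ (dot p) [set t]) => [z _|]; first exact: dot_continuousr.
    exact: closed_eq.
  - by exists y.
  - exact: dot_continuousr.
  - by exists b.
pose s q := dot q (b q).
have sA q : exists2 z, slice p t z & dot q z = s q.
  by exists (b q) => //; case: (bP q).
have sM q z : slice p t z -> dot q z <= s q by case: (bP q) => _; apply.
have ssym := slice_support_sym p0 pa sA sM ty Csym.
apply: convex_separation => [//|//||q]; first by exists a.
(* Adding a multiple of [p] changes [q] by a constant on the slice and makes it orthogonal to [a],
   where the support function is even. *)
pose w := q - (dot q a / dot p a) *: p.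
have wa : dot w a = 0 by rewrite !dotE divfK ?subrr// gt_eqF.
have [z [Cz pz] wz] := sA w; exists z => //.
have : dot w (- y) <= dot w z.
  by rewrite wz ssym// dotNr -dotNl; apply: sM.
rewrite !dotE pz -/t => h.
rewrite [leLHS](_ : _ = - (dot q y) + 2 * (dot q a / dot p a * t)); last by ring.
lra.
Qed.

End HalfTurn.

(** * Ellipsoids of maximal volume *)

Section MaximalEllipsoid.
Context {R : realType}.

(** The matrix determinant lemma, read off from two factorizations of one block matrix. *)
Lemma det_rank1_update (n : nat) (v w : 'rV[R]_n) : \det (1%:M + v^T *m w) = 1 + dot v w.
Proof.
have e1 : block_mx (1%:M : 'M[R]_1) 0 (v^T) (1%:M : 'M[R]_n) *m
    block_mx 1%:M (- w) 0 (1%:M + v^T *m w) =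
    block_mx 1%:M (- w) (v^T) 1%:M.
  rewrite mulmx_block !(mul1mx, mulmx1, mul0mx, mulmx0, addr0).
  by rewrite mulmxN addrC addrK.
have e2 : block_mx (1%:M : 'M[R]_1) (- w) 0 (1%:M : 'M[R]_n) *m
    block_mx (1%:M + w *m v^T) 0 (v^T) 1%:M =
    block_mx 1%:M (- w) (v^T) 1%:M.
  by rewrite mulmx_block !(mul1mx, mulmx1, mul0mx, mulmx0, add0r) mulNmx addrK.
have := congr1 determinant e1; rewrite -e2 !det_mulmx !det_lblock !det_ublock.
rewrite !det1 !mul1r !mulr1 => ->.
rewrite det_mx11 !mxE eqxx mulr1n; congr (_ + _); apply: eq_bigr => i _.
by rewrite mxE mulrC.
Qed.

Variables (C : set 'rV[R]_3) (h : 'rV[R]_3 -> R) (e : R).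
Implicit Types (a p q x y : 'rV[R]_3) (M N : 'M[R]_3).
Hypothesis h_attained : forall q, exists2 b, C b & dot q b = h q.
Hypothesis h_max : forall q y, C y -> dot q y <= h q.
Hypothesis e_gt0 : 0 < e.
Hypothesis Cball : forall x, dot x x <= e ^+ 2 -> C x.

Lemma support_ge q : e * Num.sqrt (dot q q) <= h q.
Proof.
have [->|q0] := eqVneq q 0.
  rewrite dot0r sqrtr0 mulr0; have := @h_max 0 0; rewrite dot0l; apply; apply: Cball.
  by rewrite dot0l exprn_ge0// ltW.
set s := Num.sqrt _; have s0 : 0 < s by rewrite sqrtr_gt0 dot_gt0.
have ss : s ^+ 2 = dot q q by rewrite sqr_sqrtr// dot_ge0.
have -> : e * s = dot q ((e / s) *: q).
  by rewrite dotZr -ss; field; rewrite gt_eqF.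
apply/h_max/Cball; rewrite dotZl dotZr -ss le_eqVlt; apply/orP; left; apply/eqP.
by field; rewrite gt_eqF.
Qed.

Lemma support_ge0 q : 0 <= h q.
Proof. by apply: le_trans (support_ge q); rewrite mulr_ge0 ?sqrtr_ge0// ltW. Qed.

(* The ellipsoid [x *m M], with [x] in the unit ball, is contained in [C],
   expressed by comparing support functions. *)
Definition fits M := forall q, dot (q *m M^T) (q *m M^T) <= h q ^+ 2.

(** The fitting matrices form a closed set, and [h] at the unit vectors bounds their entries; so the
    continuous determinant attains its maximum. *)
Lemma fits_max : exists2 M, fits M & forall N, fits N -> \det N <= \det M.
Proof.
pose S := [set v : 'rV[R]_(3 * 3) | fits (vec_mx v)].
have cent i j : continuous (fun v : 'rV[R]_(3 * 3) => (vec_mx v : 'M[R]_3) i j).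
  rewrite (_ : (fun _ => _) = (fun v : 'rV[R]_(3 * 3) => v 0 (mxvec_index i j))).
    exact: coord_continuous.
  by apply/funext => v; rewrite mxE.
have cS : closed S.
  have -> : S = \bigcap_q [set v | dot (q *m (vec_mx v)^T) (q *m (vec_mx v)^T) <= h q ^+ 2].
    by apply/seteqP; split=> [v Sv q _|v Sv q]; [exact: Sv|exact: (Sv q I)].
  apply: closed_bigI => q _.
  pose g v := dot (q *m (vec_mx v : 'M[R]_3)^T) (q *m (vec_mx v : 'M[R]_3)^T).
  apply: (@closed_comp _ _ g [set r | r <= h q ^+ 2]) => [v _|]; last exact: closed_le.
  suff : continuous g by apply.
  rewrite (_ : g = fun v => \sum_i (\sum_j q 0 j * (vec_mx v : 'M[R]_3) i j) *
      (\sum_j q 0 j * (vec_mx v : 'M[R]_3) i j)); last first.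
    apply/funext => u; apply: eq_bigr => i _.
    have -> : (q *m (vec_mx u)^T) 0 i = \sum_j q 0 j * (vec_mx u : 'M[R]_3) i j.
      by rewrite mxE; apply: eq_bigr => j _; rewrite mxE.
    by [].
  have cl i : continuous (fun v : 'rV[R]_(3 * 3) => \sum_j q 0 j * (vec_mx v : 'M[R]_3) i j).
    by apply: continuous_sum_fun => j; apply: continuous_mull_fun; exact: cent.
  by apply: continuous_sum_fun => i; apply: continuous_mul_fun; exact: cl.
have bS : S `<=` [set v | forall k,
    `[- \sum_i h (delta_mx 0 i), \sum_i h (delta_mx 0 i)]%classic (v 0 k)].
  move=> v Sv k; case/mxvec_indexP: k => i j.
  have -> : v 0 (mxvec_index i j) = (vec_mx v : 'M[R]_3) i j by rewrite mxE.
  have := Sv (delta_mx 0 j); set M := vec_mx v => Mj.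
  have Mh : `|M i j| <= h (delta_mx 0 j).
    rewrite -ler_sqr ?nnegrE ?support_ge0// real_normK ?num_real//.
    apply: le_trans Mj; rewrite -rowE /dot (bigD1 i)//= !mxE -expr2 lerDl.
    by apply: sumr_ge0 => l _; rewrite -expr2 sqr_ge0.
  rewrite /= in_itv/= -ler_norml; apply: le_trans Mh _.
  rewrite (bigD1 j)//= lerDl; apply: sumr_ge0 => l _; exact: support_ge0.
have compS : compact S.
  apply: (subclosed_compact cS _ bS).
  apply: (rV_compact (A := fun=> `[_, _]%classic)) => _; exact: segment_compact.
have [||v Sv vmax] := @compact_max_ex R _ S (fun v => \det (vec_mx v : 'M[R]_3)) compS.
- exists 0 => q; rewrite linear0 trmx0 mulmx0 dot0l sqr_ge0 //.
- apply: continuous_sum_fun => s; apply: continuous_mull_fun.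
  by apply: continuous_big => [|i _]; [exact: mul_continuous|exact: cent].
exists (vec_mx v) => // N fN; rewrite -[N]mxvecK; apply: vmax.
by rewrite /S /= mxvecK.
Qed.

Lemma fits_max_det_gt0 M : (forall N, fits N -> \det N <= \det M) -> 0 < \det M.
Proof.
move=> Mmax; apply: (@lt_le_trans _ _ (\det (e%:M : 'M[R]_3))).
  by rewrite det_scalar exprn_gt0.
apply: Mmax => q; rewrite tr_scalar_mx mul_mx_scalar dotZl dotZr mulrA -expr2.
have := support_ge q; set s := Num.sqrt _ => sq.
have -> : dot q q = s ^+ 2 by rewrite sqr_sqrtr// dot_ge0.
by rewrite -exprMn ler_sqr ?nnegrE ?support_ge0// mulr_ge0 ?sqrtr_ge0// ltW.
Qed.

(* If [a] were not conjugate to [p] for the form [q |-> |q *m M^T|^2], then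
   averaging this form with its image under the half-turn would give a form
   that still fits, with larger determinant [\det N ^ 2 * \det M ^ 2]. *)
Lemma fits_max_conjugate M p a : fits M ->
  (forall N, fits N -> \det N <= \det M) -> 0 < dot p a ->
  (forall q, h ((2 * dot q a / dot p a) *: p - q) <= h q) ->
  forall q, dot q a * dot (p *m M^T) (p *m M^T) =
            dot p a * dot (q *m M^T) (p *m M^T).
Proof.
move=> fM Mmax pa0 hT q0.
have dM := fits_max_det_gt0 Mmax.
have uM : M \in unitmx by rewrite unitmxE unitfE gt_eqF.
(* In the coordinates of the ellipsoid the half-turn is governed by [x], and conjugacy means that
   [x] is parallel to [p'], that is [w = 0] below. *)
pose x := (dot p a)^-1 *: (a *m invmx M).
have qx q : dot (q *m M^T) x = dot q a / dot p a.
  by rewrite dotZr mulrC dotC -dot_mulmx mulmxKV// dotC.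
clearbody x; pose p' := p *m M^T.
have px : dot p' x = 1 by rewrite qx divff ?gt_eqF.
have A0 : 0 < dot p' p'.
  by rewrite dot_gt0; apply/eqP => p'0; move: px; rewrite p'0 dot0l => /eqP;
  rewrite eq_sym oner_eq0.
rewrite -/p'; set A := dot p' p' in A0 *.
pose w := x - A^-1 *: p'.
have p'w : dot p' w = 0 by rewrite !dotE px -/A mulVf ?subrr// gt_eqF.
have xE : x = w + A^-1 *: p' by rewrite /w subrK.
clearbody w; suff w0 : w = 0.
  have := qx q0; rewrite xE w0 add0r dotZr => /(congr1 (fun r : R => r * (dot p a * A))).
  rewrite [LHS](_ : _ = dot p a * dot (q0 *m M^T) p'); last by field; rewrite gt_eqF.
  by rewrite [RHS](_ : _ = dot q0 a * A) => [->//|]; field; rewrite gt_eqF.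
apply/eqP; apply: contraT; rewrite -dot_gt0 => W0.
set W := dot w w in W0.
pose r := Num.sqrt (1 + A * W).
have AW : 0 < A * W by rewrite mulr_gt0.
have r2 : r ^+ 2 = 1 + A * W by rewrite sqr_sqrtr//; lra.
have r1 : 1 < r.
  by rewrite -ltr_sqr ?nnegrE ?sqrtr_ge0// r2 expr1n ltrDl.
(* The positive root of [g ^+ 2 * W + 2 * g = A]: with it, the averaged form is the squared norm
   after the rank-one update by [v] and [w]. *)
pose g := (r - 1) / W.
have g0 : 0 < g by rewrite divr_gt0// subr_gt0.
have gE : g ^+ 2 * W + 2 * g = A.
  have -> : g ^+ 2 * W + 2 * g = (r ^+ 2 - 1) / W by rewrite /g; field; rewrite gt_eqF.
  by rewrite r2; field; rewrite gt_eqF.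
pose v := p' + g *: w.
have : \det ((1%:M + v^T *m w) *m M) <= \det M.
  apply: Mmax => q; rewrite trmx_mul linearD/= trmx1 trmx_mul trmxK mulmxA.
  set q' := q *m M^T.
  have -> : q' *m (1%:M + w^T *m v) = q' + dot q' w *: v.
    rewrite mulmxDr mulmx1 mulmxA; congr (_ + _).
    rewrite [q' *m w^T]mx11_scalar mul_scalar_mx; congr (_ *: _).
    by rewrite mxE; apply: eq_bigr => i _; rewrite [w^T i 0]mxE.
  have half : dot (q' + dot q' w *: v) (q' + dot q' w *: v) =
     (dot q' q' + dot ((2 * dot q' x) *: p' - q') ((2 * dot q' x) *: p' - q')) / 2.
    have -> : dot q' x = dot q' w + dot q' p' / A by rewrite xE !dotE mulrC.
    have wp : dot w p' = 0 by rewrite dotC.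
    have vv : dot v v = A + g ^+ 2 * W by rewrite /v !dotE p'w wp -/A -/W; ring.
    have qv : dot q' v = dot q' p' + g * dot q' w by rewrite /v !dotE.
    have vq : dot v q' = dot q' p' + g * dot q' w by rewrite dotC.
    move: vv qv vq; move: v => v0 vv qv vq; rewrite !dotE vv qv vq (dotC p' q') -/A.
    have -> : A + g ^+ 2 * W = 2 * A - 2 * g by lra.
    by field; rewrite gt_eqF.
  rewrite half; have Tq : (2 * dot q' x) *: p' - q' = ((2 * dot q a / dot p a) *: p - q) *m M^T.
    by rewrite mulmxBl -scalemxAl qx mulrA.
  rewrite Tq; have := fM ((2 * dot q a / dot p a) *: p - q); rewrite -Tq.
  have := fM q; rewrite -/q' => h1 h2.
  have := hT q; rewrite -ler_sqr ?nnegrE ?support_ge0//; lra.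
(* The update multiplies the determinant by [1 + g * W > 1], against maximality. *)
rewrite det_mulmx det_rank1_update ger_pMl// -subr_ge0 => h1.
have : dot v w = g * W by rewrite /v !dotE p'w -/W add0r.
have : 0 < g * W by rewrite mulr_gt0.
lra.
Qed.

End MaximalEllipsoid.

(** * The symmetric case *)

Section SymmetricEllipsoid.
Context {R : realType}.
Implicit Types (p q x y : 'rV[R]_3).

(* A farthest point in the direction of [p], with the small quadratic term
   [eps * |y|^2] added, is strictly exposed by [p + 2 eps a]. *)
Lemma exposes_dense (C : set 'rV[R]_3) p (eps : R) : compact C -> C !=set0 ->
  0 < eps -> exists a, exposes C (p + (2 * eps) *: a) a.
Proof.
move=> cC C0 eps0.
have [a Ca amax] : exists2 a, C a & forall y, C y ->
    dot p y + eps * dot y y <= dot p a + eps * dot a a.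
  apply: compact_max_ex => //.
  have c1 : continuous (dot p) := @dot_continuousr _ _ p.
  have c2 : continuous (fun y : 'rV[R]_3 => eps * dot y y).
    apply: continuous_mull_fun; apply: (@dot_continuous _ _ _ id id) => x; exact: cvg_id.
  move=> x; apply: (@cvgD _ _ _ (nbhs x) _ (dot p) (fun y => eps * dot y y));
    [exact: c1|exact: c2].
have gap y : C y -> dot (p + (2 * eps) *: a) y + eps * dot (a - y) (a - y) <=
    dot (p + (2 * eps) *: a) a.
  by move=> /amax; rewrite !dotE (dotC y a); lra.
exists a; split=> // y Cy; have := gap y Cy.
  by have := mulr_ge0 (ltW eps0) (dot_ge0 (a - y)); lra.
move=> h e; have : dot (a - y) (a - y) <= 0.
  by rewrite -(pmulr_rle0 _ eps0); lra.
rewrite le_eqVlt ltNge dot_ge0 orbF dot_eq0 subr_eq0 => /eqP->.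
by [].
Qed.

Lemma le0_small (x z d : R) : 0 < d ->
  (forall eps, 0 < eps -> eps <= d -> x <= eps * z) -> x <= 0.
Proof.
move=> d0 H; rewrite leNgt; apply/negP => x0.
have z0 : 0 < z by rewrite -(pmulr_rgt0 _ d0); exact: lt_le_trans (H d d0 (lexx _)).
have e0 : 0 < Num.min d (x / (2 * z)) by rewrite lt_min d0 divr_gt0// mulr_gt0.
have := H _ e0; rewrite ge_min lexx => /(_ isT).
have : Num.min d (x / (2 * z)) * (2 * z) <= x.
  by rewrite -ler_pdivlMr ?mulr_gt0// ge_min lexx orbT.
lra.
Qed.

Variable C : set 'rV[R]_3.
Hypothesis Ccompact : compact C.
Hypothesis Cconvex : convex_set C.
Hypothesis Csym : forall x, C x -> C (- x).
Variable e : R.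
Hypothesis e_gt0 : 0 < e.
Hypothesis Cball : forall x, dot x x <= e ^+ 2 -> C x.
Hypothesis Cproj : has_linear_projections C.

(** The conclusion identifies the support function of [C] with that of the image of the unit ball
    under [M]. Conjugacy at exposing directions, extended by density, makes [h] radial in the
    coordinates of the maximal ellipsoid. *)
Lemma symmetric_ellipsoid : exists2 M : 'M[R]_3, M \in unitmx &
  forall q b, C b -> (forall y, C y -> dot q y <= dot q b) ->
  dot q b = Num.sqrt (dot (q *m M^T) (q *m M^T)).
Proof.
have C0 : C 0 by apply: Cball; rewrite dot0l exprn_ge0// ltW.
have Cn0 : C !=set0 by exists 0.
have /choice[b bP] q : exists b, C b /\ forall y, C y -> dot q y <= dot q b.
  have [y Cy ymax] := compact_max_ex Ccompact Cn0 (@dot_continuousr _ _ q).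
  by exists y.
pose h q := dot q (b q).
have hA q : exists2 y, C y & dot q y = h q by exists (b q) => //; case: (bP q).
have hM q y : C y -> dot q y <= h q by case: (bP q) => _; apply.
have h0 q : 0 <= h q by apply: (support_ge0 hM e_gt0 Cball).
have hE q y : C y -> (forall z, C z -> dot q z <= dot q y) -> dot q y = h q.
  move=> Cy ymax; apply/eqP; rewrite eq_le hM//=; apply: ymax; by case: (bP q).
have [M fM Mmax] := fits_max hM e_gt0 Cball.
have dM := fits_max_det_gt0 hM e_gt0 Cball Mmax.
have uM : M^T \in unitmx by rewrite unitmx_tr unitmxE unitfE gt_eqF.
pose n q := q *m M^T.
have nD p q (c : R) : n (p + c *: q) = n p + c *: n q by rewrite /n mulmxDl scalemxAl.
have exposed p a q : exposes C p a -> h p * dot (n p) (n q) <= h q * dot (n p) (n p).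
  move=> pa; have [p0|p0] := eqVneq p 0; first by rewrite p0 /n mul0mx !dot0l !mulr0.
  have pa0 := exposed_gt0 e_gt0 Cball p0 pa.
  have [Ca amax _] := pa.
  have hT v : h ((2 * dot v a / dot p a) *: p - v) <= h v.
    have [y Cy <-] := hA ((2 * dot v a / dot p a) *: p - v).
    have := hM v _ (half_turn Ccompact Cconvex e_gt0 Cball Cproj Csym p0 pa Cy).
    by apply: le_trans; rewrite le_eqVlt; apply/orP; left; apply/eqP; rewrite !dotE; ring.
  have := fits_max_conjugate hM e_gt0 Cball fM Mmax pa0 hT q.
  rewrite -/(n p) -/(n q) (dotC (n q)) -(hE p a)// => <-.
  by rewrite ler_wpM2r ?dot_ge0// hM.
have bnd (v : 'rV[R]_3) a : C a -> `|dot v a| <= h v.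
  move=> Ca; rewrite ler_norml hM// andbT lerNl -dotNr.
  by apply/hM/Csym.
have [D D0 DP] : exists2 D, 0 <= D & forall x y, C x -> C y -> dot x y <= D.
  have [c Cc cmax] : exists2 c, C c & forall y, C y -> dot y y <= dot c c.
    apply: compact_max_ex => //.
    by apply: (@dot_continuous _ _ _ id id) => x; exact: cvg_id.
  exists (dot c c); first exact: dot_ge0.
  move=> x y /cmax xc /cmax yc; have := dot_ge0 (x - y); rewrite !dotE (dotC y x).
  by lra.
(* Replace [p] by the exposing direction [p + (2 * eps) *: a]; [K] bounds every error term, so the
   loss is of order [eps]. *)
have all_dirs p q : h p * dot (n p) (n q) <= h q * dot (n p) (n p).
  have [npq|npq] := leP (dot (n p) (n q)) 0.
    apply: (@le_trans _ _ 0); last by rewrite mulr_ge0 ?dot_ge0.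
    by rewrite mulr_ge0_le0.
  set X := dot (n p) (n q) in npq *; set A := dot (n p) (n p).
  have nqa v a : dot (n v) (n a) = dot (n v *m M) a.
    by rewrite dot_mulmx.
  pose K := 1 + D + D ^+ 2 + h (n q *m M) + h (n p *m M).
  have K_ge : [/\ 0 < K, D <= K, D ^+ 2 <= K, h (n q *m M) <= K & h (n p *m M) <= K].
    have := h0 (n q *m M); have := h0 (n p *m M); have := sqr_ge0 D.
    by rewrite /K; split; lra.
  have [K0 DK D2K K1 K2] := K_ge.
  (* The cap [X / (2 * K)] keeps the perturbed product nonnegative, and the cap 1 absorbs the term
     in [eps ^+ 2]. *)
  rewrite -subr_le0; apply: (@le0_small _ (2 * K * h p + 2 * K * (X + 2 * K) + 8 * K * h q)
    (Num.min 1 (X / (2 * K)))).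
    by rewrite lt_min ltr01 divr_gt0// mulr_gt0.
  move=> eps eps0; rewrite le_min ler_pdivlMr ?mulr_gt0// => /andP[eps1 epsX].
  have [a pa] := @exposes_dense C p eps Ccompact Cn0 eps0.
  have [Ca _ _] := pa; have := exposed _ _ q pa; set p' := _ + _.
  have hp' : h p - 2 * eps * K <= h p'.
    have [Cb _] := bP p; have := hM p' _ Cb; rewrite /p' !dotE -/(h p).
    have := DP _ _ (Csym Ca) Cb; rewrite dotNl => h1 h2.
    apply: le_trans h2; rewrite lerD2l -mulrN ler_pM2l ?mulr_gt0//; lra.
  have na2 : dot (n a) (n a) <= K.
    apply: le_trans (fM a) _; apply: le_trans D2K.
    rewrite ler_sqr ?nnegrE//; have [y Cy <-] := hA a; exact: DP.
  have /ler_normlP[naq1 naq2] : `|dot (n q) (n a)| <= K by rewrite nqa (le_trans (bnd _ _ Ca)).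
  have /ler_normlP[nap1 nap2] : `|dot (n p) (n a)| <= K by rewrite nqa (le_trans (bnd _ _ Ca)).
  have -> : dot (n p') (n q) = X + 2 * eps * dot (n q) (n a).
    by rewrite /p' nD !dotE (dotC (n a)).
  have -> : dot (n p') (n p') = A + 4 * eps * dot (n p) (n a) + 4 * eps ^+ 2 * dot (n a) (n a).
    by rewrite /p' nD !dotE (dotC (n a) (n p)) -/A; ring.
  move: (dot (n a) (n a)) (dot (n q) (n a)) (dot (n p) (n a)) na2 naq1 naq2 nap1 nap2.
  move=> s u t sK u1 u2 t1 t2 main.
  have eK : 0 < eps * K by exact: mulr_gt0.
  have Y1 : X - 2 * (eps * K) <= X + 2 * eps * u by nra.
  have Y2 : X + 2 * eps * u <= X + 2 * K by nra.
  have Y0 : 0 <= X + 2 * eps * u by apply: le_trans Y1; lra.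
  have R1 : A + 4 * eps * t + 4 * eps ^+ 2 * s <= A + 8 * (eps * K).
    have : eps * t <= eps * K by rewrite ler_pM2l//; lra.
    have : eps ^+ 2 * s <= eps * K.
      apply: (@le_trans _ _ (eps ^+ 2 * K)); first by rewrite ler_wpM2l ?sqr_ge0.
      by rewrite ler_pM2r// expr2 ler_piMl// ltW.
    lra.
  have := ler_wpM2r Y0 hp'; have := ler_wpM2l (h0 q) R1.
  have := ler_wpM2l (h0 p) Y1; have := ler_wpM2l (ltW eK) Y2.
  lra.
have [|r r0 hr] := @radial_const R (fun z => h (z *m invmx M^T)).
  move=> z z' z0 z'0; have := all_dirs (z *m invmx M^T) (z' *m invmx M^T).
  by rewrite /n !mulmxKV.
have hrn q : h q = r * Num.sqrt (dot (n q) (n q)).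
  have [q0|q0] := eqVneq q 0.
    by rewrite q0 /n mul0mx dot0l sqrtr0 mulr0 /h dot0l.
  have nq0 : n q != 0.
    by apply: contra_neq q0 => /(congr1 (mulmx^~ (invmx M^T))); rewrite /= /n mulmxK// mul0mx.
  by rewrite -hr// /n mulmxK.
(* [C] contains a ball, so its support function is positive off 0. *)
have rgt0 : 0 < r.
  rewrite lt_neqAle r0 andbT; apply/eqP => r00.
  have c0 : const_mx 1 != 0 :> 'rV[R]_3.
    by apply/eqP => /rowP/(_ 0)/eqP; rewrite !mxE oner_eq0.
  have := support_ge hM e_gt0 Cball (const_mx 1).
  rewrite hrn -r00 mul0r leNgt mulr_gt0// sqrtr_gt0 dot_gt0 //.
exists (r *: M).
  by rewrite unitmxZ ?unitfE ?gt_eqF// unitmxE unitfE gt_eqF.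
move=> q y Cy ymax; rewrite (hE q y)// hrn linearZ/= -scalemxAr dotZl dotZr mulrA -expr2.
by rewrite sqrtrM ?sqr_ge0// sqrtr_sqr ger0_norm.
Qed.

End SymmetricEllipsoid.

(** * Bodies of constant width with projections *)

Section ConstantWidth.
Context {R : realType}.
Implicit Types (B : set 'rV[R]_3) (p q u v x y z : 'rV[R]_3).

Definition maximizes B q b := B b /\ forall y, B y -> dot q y <= dot q b.

Variable B : set 'rV[R]_3.
Hypothesis B_attained : forall q, exists b, maximizes B q b.
Hypothesis B_separated : forall x,
  (forall q, exists2 b, B b & dot q x <= dot q b) -> B x.
Hypothesis B_proj : has_projections B.
Hypothesis B_width : forall q b b', maximizes B q b -> maximizes B (- q) b' ->
  dot q (b - b') = Num.sqrt (dot q q).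

(** With [v = x - y], the squared norm of [v] is at most the width in direction [v], which is the
    norm of [v]. *)
Lemma width_diameter x y : B x -> B y -> dot (x - y) (x - y) <= 1.
Proof.
move=> Bx By; have [v vE] : exists v, v = x - y by eexists.
rewrite -vE; have [b bv] := B_attained v; have [b' bv'] := B_attained (- v).
have := B_width bv bv'; rewrite dotDr dotNr; set s := Num.sqrt _ => w.
have h1 := proj2 bv x Bx; have := proj2 bv' y By; rewrite !dotNl => h2.
have vv : dot v v = dot v x - dot v y by rewrite {2}vE dotDr dotNr.
have s0 : 0 <= s by exact: sqrtr_ge0.
have ss : dot v v = s ^+ 2 by rewrite sqr_sqrtr// dot_ge0.
by rewrite ss in vv *; nra.
Qed.

(** The difference has component 1 along the unit vector of [q] and length at most 1. *)
Lemma width_antipode q b b' : q != 0 -> maximizes B q b ->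
  maximizes B (- q) b' -> b - b' = (Num.sqrt (dot q q))^-1 *: q.
Proof.
move=> q0 bq bq'; set s := Num.sqrt _.
have s0 : 0 < s by rewrite sqrtr_gt0 dot_gt0.
have ss : dot q q = s ^+ 2 by rewrite sqr_sqrtr// dot_ge0.
have w := B_width bq bq'; rewrite -/s in w.
have d := width_diameter (proj1 bq) (proj1 bq').
move: (b - b') w d => v w d; apply/eqP; rewrite -subr_eq0 -dot_eq0 eq_le dot_ge0 andbT.
rewrite !dotE (dotC v q) w ss.
rewrite [leLHS](_ : _ = dot v v - 1) ?subr_le0//.
by field; rewrite gt_eqF.
Qed.

Lemma maximizes_unique q y y' : q != 0 -> maximizes B q y -> maximizes B q y' ->
  y = y'.
Proof.
move=> q0 yq yq'; have [b bq] := B_attained (- q).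
by apply: (addIr (- b)); rewrite !(width_antipode q0 _ bq).
Qed.

(** For [v] orthogonal to [u], project two opposite touching points for [v]: their unit difference
    gains an orthogonal component proportional to [dot f v], which the diameter bound forces to
    vanish. *)
Lemma projection_orthogonal u f (c : R) : u != 0 -> dot f u = 1 ->
  (forall x, B x -> B (x - (dot f x - c) *: u)) ->
  f = (dot u u)^-1 *: u.
Proof.
move=> u0 fu Pf; have uu : dot u u != 0 by rewrite dot_eq0.
have perp v : dot u v = 0 -> dot f v = 0.
  move=> uv; have [->|v0] := eqVneq v 0; first exact: dot0r.
  have [b bv] := B_attained v; have [b' bv'] := B_attained (- v).
  have := width_diameter (Pf _ (proj1 bv)) (Pf _ (proj1 bv')).
  have -> : b - (dot f b - c) *: u - (b' - (dot f b' - c) *: u) =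
      (b - b') - dot f (b - b') *: u.
    by rewrite dotDr dotNr; apply/rowP => i; rewrite !mxE; ring.
  rewrite (width_antipode v0 bv bv'); set s := Num.sqrt _.
  have s0 : 0 < s by rewrite sqrtr_gt0 dot_gt0.
  have ss : dot v v = s ^+ 2 by rewrite sqr_sqrtr// dot_ge0.
  rewrite !dotE (dotC v u) uv ss.
  rewrite [leLHS](_ : _ = 1 + (dot f v / s) ^+ 2 * dot u u); last by field; rewrite gt_eqF.
  rewrite gerDl pmulr_lle0 ?dot_gt0// => h.
  have : (dot f v / s) ^+ 2 == 0 by rewrite eq_le h sqr_ge0.
  by rewrite sqrf_eq0 mulf_eq0 invr_eq0 (gt_eqF s0) orbF => /eqP.
have [w wE] : exists w, w = f - (dot u u)^-1 *: u by eexists.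
have uw : dot u w = 0 by rewrite wE dotDr dotNr dotZr mulVf// dotC fu subrr.
have : dot w w == 0 by rewrite {1}wE dotDl dotNl dotZl uw (perp _ uw) mulr0 subrr.
by rewrite dot_eq0 wE subr_eq0 => /eqP.
Qed.

(** The projection along [u] preserves height in direction [p], so by uniqueness it fixes the
    touching point; this puts the point on the plane [dot f y = c]. *)
Lemma touching_coordinate u : exists d : R, forall p y, p != 0 -> dot p u = 0 ->
  maximizes B p y -> dot u y = d.
Proof.
have [->|u0] := eqVneq u 0; first by exists 0 => p y _ _ _; exact: dot0l.
have [f [c [fu Pf]]] := B_proj u0.
have uu : dot u u != 0 by rewrite dot_eq0.
exists (dot u u * c) => p y p0 pu py.
have Py : maximizes B p (y - (dot f y - c) *: u).
  split; first exact: (Pf _ (proj1 py)).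
  by move=> x Bx; rewrite dotDr dotNr dotZr pu mulr0 subr0; exact: (proj2 py).
have /eqP := maximizes_unique p0 Py py.
rewrite -subr_eq0 addrAC subrr add0r oppr_eq0 scaler_eq0 (negPf u0) orbF subr_eq0.
move=> /eqP <-; rewrite (projection_orthogonal u0 fu Pf) dotZl mulrA divff//.
by rewrite mul1r.
Qed.

(** A normal orthogonal to both [u] and [v] has one touching point that computes [d] at all their
    combinations, so [d] is linear and [z] represents it. Then [y - z] is orthogonal to everything
    orthogonal to [p]. *)
Lemma touching_center : exists z, forall p y, p != 0 -> maximizes B p y ->
  y - z = (dot p (y - z) / dot p p) *: p.
Proof.
have /choice[d dP] := touching_coordinate.
have dlin (k : R) u v : d (k *: u + v) = k * d u + d v.
  have [p [p0 pu pv]] := perp2_ex u v; have [y py] := B_attained p.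
  rewrite -(dP u p y)// -(dP v p y)// -(dP _ p y)//.
    by rewrite dotDl dotZl.
  by rewrite dotDr dotZr pu pv mulr0 addr0.
have dD : {morph d : u v / u + v >-> u + v}.
  by move=> u v; have := dlin 1 u v; rewrite scale1r mul1r.
have d0 : d 0 = 0 by have := dlin (-1) 0 0; rewrite scaler0 addr0; lra.
pose z := \row_i d (delta_mx 0 i).
have dz u : d u = dot u z.
  rewrite {1}(row_sum_delta u) (big_morph d dD d0); apply: eq_bigr => i _.
  by have := dlin (u 0 i) (delta_mx 0 i) 0; rewrite !addr0 d0 addr0 => ->; rewrite mxE.
exists z => p y p0 py; have pp : dot p p != 0 by rewrite dot_eq0.
have [w wE] : exists w, w = y - z by eexists.
have perp u : dot p u = 0 -> dot u w = 0.
  by move=> pu; rewrite wE dotDr dotNr -dz (dP u p y) // subrr.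
rewrite -wE; have [v vE] : exists v, v = w - (dot p w / dot p p) *: p by eexists.
have pv : dot p v = 0 by rewrite vE dotDr dotNr dotZr divfK// subrr.
have : dot v v == 0.
  by rewrite {2}vE dotDr dotNr dotZr (dotC v p) pv mulr0 subr0 (perp _ pv).
by rewrite dot_eq0 vE subr_eq0 => /eqP.
Qed.

Lemma constant_width_ball : exists z,
  B = [set x | dot (x - z) (x - z) <= (1 / 2) ^+ 2].
Proof.
have [z zP] := touching_center; exists z.
have /choice[b bP] := B_attained.
pose g p := dot p (b p - z).
have [|r r0 gr] := @radial_const R g.
  move=> p q p0 q0; have pp : 0 < dot p p by rewrite dot_gt0.
  rewrite -ler_pdivrMr// mulrAC (dotC p q) -dotZr -zP//.
  by rewrite /g !dotDr lerD2r; exact: (proj2 (bP q) _ (proj1 (bP p))).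
(* Opposite values of [g] add up to the width, which is the norm. *)
have {r0}r12 : r = 1 / 2.
  pose p : 'rV[R]_3 := const_mx 1.
  have p0 : p != 0 by apply/eqP => /rowP/(_ 0)/eqP; rewrite !mxE oner_eq0.
  have s0 : 0 < Num.sqrt (dot p p) by rewrite sqrtr_gt0 dot_gt0.
  have := B_width (bP p) (bP (- p)).
  have -> : dot p (b p - b (- p)) = g p + g (- p).
    by rewrite /g dotNl -dotNr -dotDr; congr dot; rewrite opprB addrA subrK.
  rewrite !gr ?oppr_eq0// dotNl dotNr opprK -mulrDl -[RHS]mul1r.
  by move/(mulIf (lt0r_neq0 s0)); lra.
have gE p : g p = 1 / 2 * Num.sqrt (dot p p).
  have [->|p0] := eqVneq p 0; last by rewrite gr// r12.
  by rewrite /g !dot0l sqrtr0 mulr0.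
apply/seteqP; split=> [x Bx|x /= xz].
- have [v vE] : exists v, v = x - z by eexists.
  rewrite /= -vE; have : dot v v <= g v.
    by rewrite {2}vE /g !dotDr lerD2r; exact: (proj2 (bP v)).
  rewrite gE; set s := Num.sqrt _; have s0 : 0 <= s by exact: sqrtr_ge0.
  have -> : dot v v = s ^+ 2 by rewrite sqr_sqrtr// dot_ge0.
  by nra.
- apply: B_separated => q; exists (b q); first exact: (proj1 (bP q)).
  rewrite -(lerD2r (- dot q z)) -!dotNr -!dotDr -/(g q) gE.
  apply: le_trans (ler_norm _) _.
  rewrite -ler_sqr ?nnegrE// ?mulr_ge0 ?sqrtr_ge0 ?divr_ge0//.
  rewrite real_normK ?num_real// exprMn sqr_sqrtr ?dot_ge0//.
  apply: le_trans (cauchy_schwarz _ _) _.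
  by rewrite mulrC ler_wpM2r// dot_ge0.
Qed.

End ConstantWidth.

(** * The difference body *)

Section DifferenceBody.
Context {R : realType}.
Variable B : set 'rV[R]_3.
Hypothesis B_body : convex_body B.

Definition difference_body : set 'rV[R]_3 :=
  [set xy.1 - xy.2 | xy in B `*` B].

Lemma difference_bodyP v :
  difference_body v <-> exists x y, [/\ B x, B y & v = x - y].
Proof.
split=> [[[x y] [/= Bx By] <-]|[x [y [Bx By ->]]]]; first by exists x, y.
by exists (x, y).
Qed.

Lemma difference_body_compact : compact difference_body.
Proof.
have [cB _ _ _] := B_body; apply: continuous_compact; last exact: compact_setX.
apply: continuous_subspaceT => z.
by apply: (@cvgB _ _ _ (nbhs z) _ fst snd); [exact: cvg_fst|exact: cvg_snd].
Qed.

Lemma difference_body_convex : convex_set difference_body.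
Proof.
have [_ /convex_setP vB _ _] := B_body; apply/convex_setP => u v t.
move=> /difference_bodyP[x [y [Bx By ->]]] /difference_bodyP[x' [y' [Bx' By' ->]]] t0 t1.
apply/difference_bodyP; exists (t *: x + (1 - t) *: x'), (t *: y + (1 - t) *: y').
by split; [exact: vB|exact: vB|apply/rowP => i; rewrite !mxE; ring].
Qed.

Lemma difference_body_sym v : difference_body v -> difference_body (- v).
Proof.
move=> /difference_bodyP[x [y [Bx By ->]]]; apply/difference_bodyP.
by exists y, x; rewrite opprB.
Qed.

Lemma difference_body_ball : exists2 e : R, 0 < e &
  forall x, dot x x <= e ^+ 2 -> difference_body x.
Proof.
have [_ _ [w /interior_dot_ball[e e0 eB]] _] := B_body; exists e => // x xe.
apply/difference_bodyP; exists (x + w), w; split.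
- by apply: eB; rewrite addrK.
- by apply: eB; rewrite subrr dot0l exprn_ge0// ltW.
- by rewrite addrK.
Qed.

(** The offset [c] cancels in differences, so affine projections become linear. *)
Lemma difference_body_projections :
  has_projections B -> has_linear_projections difference_body.
Proof.
move=> pB u u0; have [f [c [fu Pf]]] := pB u u0; exists f => //.
move=> v /difference_bodyP[x [y [Bx By ->]]]; apply/difference_bodyP.
exists (x - (dot f x - c) *: u), (y - (dot f y - c) *: u); split; [exact: Pf|exact: Pf|].
by rewrite dotDr dotNr; apply/rowP => i; rewrite !mxE; ring.
Qed.

End DifferenceBody.

(** * From the difference body back to the body *)

Lemma projections_ellipsoid (R : realType) (B : set 'rV[R]_3) :
  convex_body B -> has_projections B -> is_ellipsoid B.
Proof.
move=> bB pB; have [cB vB _ B0] := bB.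
have Bn0 : B !=set0 by exists 0.
have [e e0 eC] := difference_body_ball bB.
have [M uM widthM] := symmetric_ellipsoid (difference_body_compact bB)
  (difference_body_convex bB) (@difference_body_sym _ B) e0 eC (difference_body_projections pB).
have uMT : M^T \in unitmx by rewrite unitmx_tr.
(* In these coordinates the difference body has the support function of the unit ball, so [A] has
   constant width 1 and is a ball of radius 1/2. *)
pose A : set 'rV[R]_3 := [set x | B (x *m M)].
have dotM q x : dot q x = dot (q *m invmx M^T) (x *m M).
  by rewrite dotC -[in RHS]dotC dot_mulmx mulmxKV// dotC.
have A_max q b : maximizes A q b -> maximizes B (q *m invmx M^T) (b *m M).
  move=> [Ab bmax]; split=> // y By; rewrite -[y](mulmxKV uM) -!dotM.
  by apply: bmax; rewrite /A /= mulmxKV.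
have A_attained q : exists b, maximizes A q b.
  have [b Bb bmax] := compact_max_ex cB Bn0 (@dot_continuousr _ _ (q *m invmx M^T)).
  exists (b *m invmx M); split; first by rewrite /A /= mulmxKV.
  by move=> y Ay; rewrite (dotM q y) (dotM q (b *m invmx M)) mulmxKV//; exact: bmax.
have A_separated x : (forall q, exists2 b, A b & dot q x <= dot q b) -> A x.
  move=> H; apply: (@convex_separation _ _ B) => // q.
  have [b Ab] := H (q *m M^T); rewrite (dotM _ x) (dotM _ b) mulmxK// => qb.
  by exists (b *m M).
have A_proj : has_projections A.
  move=> u u0; have uM0 : u *m M != 0.
    by apply: contra_neq u0 => /(congr1 (mulmx^~ (invmx M))); rewrite /= mulmxK// mul0mx.
  have [f [c [fu Pf]]] := pB _ uM0; exists (f *m M^T), c.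
  have fM x : dot (f *m M^T) x = dot f (x *m M) by rewrite dotC -dot_mulmx dotC.
  split; first by rewrite fM.
  by move=> x Ax; rewrite /A /= mulmxBl -scalemxAl fM; exact: Pf.
have A_width q b b' : maximizes A q b -> maximizes A (- q) b' ->
    dot q (b - b') = Num.sqrt (dot q q).
  move=> /A_max[Bb bmax] /A_max[Bb' bmin].
  have := widthM (q *m invmx M^T) (b *m M - b' *m M).
  rewrite mulmxKV// -mulmxBl -dotM; apply.
    by apply/difference_bodyP; exists (b *m M), (b' *m M); rewrite ?mulmxBl.
  move=> v /difference_bodyP[x [y [Bx By ->]]]; rewrite !dotDr !dotNr (dotM q b) (dotM q b').
  have := bmin y By; rewrite mulNmx !dotNl => h.
  by apply: lerD => //; exact: bmax.
have [z AE] := constant_width_ball A_attained A_separated A_proj A_width.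
exists (z *m M), ((1 / 2) *: M); split.
  by rewrite unitmxZ// unitfE; lra.
apply/seteqP; split=> [x Bx|_ [y yb <-]].
- have Ax : A (x *m invmx M) by rewrite /A /= mulmxKV.
  exists (2 *: (x *m invmx M - z)).
    move: Ax; rewrite AE /= /euclidean_ball /=.
    under [in X in _ -> X]eq_bigr do rewrite expr2.
    rewrite -/(dot _ _) dotZl dotZr; lra.
  rewrite -scalemxAr -scalemxAl scalerA mulmxBl mulmxKV//.
  have -> : 1 / 2 * 2 = 1 :> R by lra.
  by rewrite scale1r addrC subrK.
- have : A (z + (1 / 2) *: y).
    rewrite AE /= addrC addKr dotZl dotZr.
    have : dot y y <= 1 by move: yb; rewrite /euclidean_ball /=; under eq_bigr do rewrite expr2.
    lra.
  by rewrite /A /= mulmxDl -scalemxAl -scalemxAr.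
Qed.

Theorem theorem4p4 (R : realType) (B : set 'rV[R]_3) :
  convex_body B -> weakly_blaschke B -> is_ellipsoid B.
Proof.
by move=> bB wB; apply: projections_ellipsoid => //; exact: weakly_blaschke_projections.
Qed.
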